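(* Let $\psi^{(i)}_{j,k}$ be the periodized wavelets on $\mathbb{T}=\mathbb{R}^d/\mathbb{Z}^d$ associated with an orthonormal $1$-smooth wavelet basis of $\mathbb{R}^d$. Let $(\chi^{i}_{j,k})$ be a sequence of I.I.D. random variables with common law $\chi$ and assume that there exist constants $C,C',a,b>0$ and an exponent $\gamma\in(0,2]$ such that, for $x>0$ large enough, $$C'e^{-ax^\gamma}\le\mathbb{P}(|\chi|\ge x)\le Ce^{-bx^\gamma}.$$ Let $\alpha\in(0,1)$ and consider the function $f$ defined on $\mathbb{T}$ by $$f=\sum_{j\in\mathbb{N}}\sum_{i,k}2^{-\alpha j}\psi^{(i)}_{j,k}.$$ Then, almost surely, the wavelet randomization $X_f=\sum_{j\in\mathbb{N}}\sum_{i,k}2^{-\alpha j}\chi^{i}_{j,k}\psi^{(i)}_{j,k}$ of $f$ satisfies $$0<\sup_{x\ne y}\frac{|X_f(x)-X_f(y)|}{|x-y|^\alpha\,\bigl|\log(|x-y|)\bigr|^{1/\gamma}}<+\infty.$$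
   Context: An orthonormal $r$-smooth ($r\ge 0$) wavelet basis on $\mathbb{R}^d$ is a collection of functions $\varphi$ and $\Psi^{(i)}$, $i\in\{1,\dots,2^d-1\}$, such that: $\varphi$, the $\Psi^{(i)}$ and all their partial derivatives up to order $r$ have fast decay (faster than any negative power of $1+|x|$); and the functions $\varphi(\cdot-k)$, $k\in\mathbb{Z}^d$, together with $2^{dj/2}\Psi^{(i)}(2^j\cdot-k)$, $j\in\mathbb{N}$, $k\in\mathbb{Z}^d$, $i\in\{1,\dots,2^d-1\}$, form an orthonormal basis of $L^2(\mathbb{R}^d)$. The periodized wavelets on $\mathbb{T}$ are $\psi^{(i)}_{j,k}(x)=\sum_{l\in\mathbb{Z}^d}\Psi^{(i)}(2^j(x-l)-k)$, for $i\in\{1,\dots,2^d-1\}$, $j\in\mathbb{N}$, $k\in\mathbb{Z}^d$ with $2^{-j}k\in[0,1)^d$; sums over $i,k$ at scale $j$ run over these indices (no $L^2$ normalization is used). On $\mathbb{T}$, $|x-y|$ denotes the quotient distance induced by the max norm of $\mathbb{R}^d$ (so $|x-y|\le 1/2$), and the supremum is over $x,y\in\mathbb{T}$ with $x\ne y$. *)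

(* Defs.v *)
From HB Require Import structures.
From mathcomp Require Import all_boot all_order all_algebra.
From mathcomp Require Import all_classical all_reals all_analysis.

Set Implicit Arguments.
Unset Strict Implicit.
Unset Printing Implicit Defensive.

Import Order.TTheory GRing.Theory Num.Theory.
Import numFieldNormedType.Exports.

Local Open Scope classical_set_scope.
Local Open Scope ring_scope.

(* R^d is 'rV[R]_d, whose norm `|x| is the max norm.  The measurable structure
   and the Lebesgue measure live on d-tuples of reals; the two are identified
   by [rv]. *)
Section lebesgue_Rd.
Context {R : realType}.

Definition rv d (t : d.-tuple (measurableTypeR R)) : 'rV[R]_d :=
  \row_m (tnth t m : R).

Definition tcons d (p : d.-tuple (measurableTypeR R) * measurableTypeR R) :
    d.+1.-tuple (measurableTypeR R) :=
  [the d.+1.-tuple (measurableTypeR R) of p.2 :: p.1].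

Lemma measurable_tcons d : measurable_fun [set: _] (@tcons d).
Proof. by apply: measurable_cons. Qed.

(* The successor case is [pushforward _ (@tcons d')], with its canonical measure
   structure named explicitly because it carries the measurability proof. *)
Fixpoint lebesgue_Rd (d : nat) :
    {measure set (d.-tuple (measurableTypeR R)) -> \bar R} :=
  match d with
  | 0%N => \d_ ([tuple] : 0.-tuple (measurableTypeR R))
  | d'.+1 => measure_function_pushforward__canonical__measure_function_Measure
      (lebesgue_Rd d' \x lebesgue_measure)%E (@measurable_tcons d')
  end.

End lebesgue_Rd.
Arguments lebesgue_Rd R d : clear implicits.

Section wavelet_bases.
Context {R : realType} {d : nat}.

Definition fast_decay (g : 'rV[R]_d -> R) : Prop :=
  forall N : nat, exists C : R, forall x, `|g x| <= C / (1 + `|x|) ^+ N.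

(* Unfolding the recursion: every iterated partial derivative of g of order at
   most r exists everywhere and has fast decay. *)
Fixpoint smooth_fast_decay (r : nat) (g : 'rV[R]_d -> R) : Prop :=
  fast_decay g /\
  match r with
  | 0%N => True
  | r'.+1 => forall m : 'I_d,
      (forall x, derivable g x (delta_mx 0 m)) /\
      smooth_fast_decay r' (fun x => 'D_(delta_mx 0 m) g x)
  end.

Definition intv (l : 'rV[int]_d) : 'rV[R]_d := \row_m (l 0 m)%:~R.

Definition basis_index : eqType :=
  ('rV[int]_d + nat * 'I_((2 ^ d).-1) * 'rV[int]_d)%type.

Definition basis_fun (phi : 'rV[R]_d -> R)
    (Psi : 'I_((2 ^ d).-1) -> 'rV[R]_d -> R) (b : basis_index) :
    'rV[R]_d -> R :=
  match b with
  | inl k => fun x => phi (x - intv k)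
  | inr (j, i, k) => fun x =>
      2 `^ (d%:R * j%:R / 2) * Psi i (2 ^+ j *: x - intv k)
  end.

(* Orthonormal basis in the Hilbert space sense: an orthonormal family of
   L^2(R^d) whose finite linear combinations are dense. *)
Definition orthonormal_basis_L2 (I : eqType) (e : I -> 'rV[R]_d -> R) : Prop :=
  [/\ forall b, e b \o @rv R d \in Lfun (lebesgue_Rd R d) 2%:E,
      forall b b', \int[lebesgue_Rd R d]_t (e b (rv t) * e b' (rv t)) =
                   (b == b')%:R &
      forall g : d.-tuple (measurableTypeR R) -> R,
        g \in Lfun (lebesgue_Rd R d) 2%:E ->
        forall eps : R, 0 < eps -> exists (s : seq I) (c : I -> R),
          (Lnorm (lebesgue_Rd R d) 2%:E
             (fun t => (g t - \sum_(b <- s) c b * e b (rv t))%:E)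
             < eps%:E)%E].

Definition wavelet_basis (r : nat) (phi : 'rV[R]_d -> R)
    (Psi : 'I_((2 ^ d).-1) -> 'rV[R]_d -> R) : Prop :=
  [/\ smooth_fast_decay r phi,
      forall i, smooth_fast_decay r (Psi i) &
      orthonormal_basis_L2 (basis_fun phi Psi)].

End wavelet_bases.

(* The torus T = R^d / Z^d is handled through representatives: functions on T
   are Z^d-periodic functions on R^d, and two points of R^d are the same point
   of T iff they satisfy [same_point]. *)
Section torus.
Context {R : realType} {d : nat}.

Definition same_point (x y : 'rV[R]_d) : Prop :=
  exists l : 'rV[int]_d, x - y = intv l.

Definition torus_dist (x y : 'rV[R]_d) : R :=
  inf [set `|x - y - intv l| | l in [set: 'rV[int]_d]].

(* Sum over Z^d, as the difference of the sums of positive and negative parts;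
   it is the usual sum when the family is absolutely summable. *)
Definition lattice_sum (F : 'rV[int]_d -> R) : R :=
  fine ((\esum_(l in [set: 'rV[int]_d]) ((EFin \o F)^\+ l))
        - (\esum_(l in [set: 'rV[int]_d]) ((EFin \o F)^\- l)))%E.

(* (j, (i, k)); the condition 2^-j k \in [0, 1)^d says that every coordinate of
   k lies in {0, ..., 2^j - 1}. *)
Definition torus_index : eqType :=
  {j : nat & ('I_((2 ^ d).-1) * 'rV['I_(2 ^ j)]_d)%type}.

Definition periodized (Psi : 'I_((2 ^ d).-1) -> 'rV[R]_d -> R)
    (u : torus_index) (x : 'rV[R]_d) : R :=
  let: existT j (i, k) := u in
  lattice_sum (fun l =>
    Psi i (2 ^+ j *: (x - intv l) - \row_m (k 0 m : nat)%:R)).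

Definition wavelet_partial_sums (Psi : 'I_((2 ^ d).-1) -> 'rV[R]_d -> R)
    (c : torus_index -> R) (x : 'rV[R]_d) : R^nat :=
  series (fun j => \sum_(ik : 'I_((2 ^ d).-1) * 'rV['I_(2 ^ j)]_d)
    c (existT _ j ik) * periodized Psi (existT _ j ik) x).

Definition wavelet_series (Psi : 'I_((2 ^ d).-1) -> 'rV[R]_d -> R)
    (c : torus_index -> R) (x : 'rV[R]_d) : R :=
  limn (wavelet_partial_sums Psi c x).

(* The supremum is over pairs of distinct points of the torus. *)
Definition log_holder_sup (alpha gamma : R) (g : 'rV[R]_d -> R) : \bar R :=
  ereal_sup [set (`|g xy.1 - g xy.2| /
                  (torus_dist xy.1 xy.2 `^ alpha *
                   `|ln (torus_dist xy.1 xy.2)| `^ gamma^-1))%:E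
            | xy in [set xy : 'rV[R]_d * 'rV[R]_d | ~ same_point xy.1 xy.2]].

End torus.
Arguments torus_index d : clear implicits.

Section randomization.
Context {dO : measure_display} {Omega : measurableType dO} {R : realType}.
Variable P : probability Omega R.

Definition mutually_independent (I : eqType) (X : I -> {RV P >-> R}) : Prop :=
  forall (s : seq I) (B : I -> set R), uniq s ->
    (forall i, measurable (B i)) ->
    P (\bigcap_(i in [set` s]) (X i @^-1` B i)) =
    (\prod_(i <- s) P (X i @^-1` B i))%E.

Definition iid_with_law (I : eqType) (X : I -> {RV P >-> R})
    (law : probability (measurableTypeR R) R) : Prop :=
  mutually_independent X /\
  forall i (B : set R), measurable B -> distribution P (X i) B = law B.

(* Coefficients, at the outcome w, of the randomization of the function
   [wavelet_series Psi c]. *)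
Definition randomized_coef {d : nat} (c : torus_index d -> R)
    (chi : torus_index d -> {RV P >-> R}) (w : Omega) : torus_index d -> R :=
  fun u => c u * chi u w.

End randomization.

(* The function of the statement is [wavelet_series Psi (f_coef alpha)], with
   coefficient 2^(- alpha j) at every index (j, (i, k)). *)
Definition f_coef {R : realType} {d : nat} (alpha : R) : torus_index d -> R :=
  fun u => 2 `^ (- (alpha * (tag u)%:R)).

(* Main.v *)
Require Import Defs.
From HB Require Import structures.
From mathcomp Require Import all_boot all_order all_algebra.
From mathcomp Require Import all_classical all_reals all_analysis.
From mathcomp Require Import measurable_realfun zify ring lra.

(* Upper bound: the tail bound and a union bound give, almost surely, a finite A
   with |chi_u| <= A (1+j)^(1/gamma) at every scale j. Fast decay bounds the
   level-j part f_j of the series by A' 2^(-alpha j) (1+j)^(1/gamma), and its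
   increments by the same quantity times 2^j |x-y|. Cutting the sum over j at
   2^(-J) ~ |x-y| gives |x-y|^alpha |log|x-y||^(1/gamma).

   Lower bound: if the supremum is not positive, the series is a constant kappa.
   Unfolded over R^d it is a bounded series of wavelets, so it can be integrated
   term by term against each integrable wavelet; orthogonality then gives
   chi_u = kappa nu_u with nu deterministic. For independent variables whose law
   charges both sides of some level this has probability zero. *)

Set Implicit Arguments.
Unset Strict Implicit.
Unset Printing Implicit Defensive.

Import Order.TTheory GRing.Theory Num.Theory.
Import numFieldNormedType.Exports.

Local Open Scope classical_set_scope.
Local Open Scope ring_scope.

(** * Lattice sums *)

(** All estimates pass through one function, [weight]. It dominates (1 + |x|)^(-2d), its sums over
    the translates by Z^d are bounded uniformly in x, and it is integrable. The uniform sums give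
    bounds per scale that ignore the number 2^(jd) of translates; integrability provides the
    dominating functions of the lower bound. There the obstacle is that a nonzero constant is not in
    L^2(R^d), so its coefficients cannot be read off from an L^2 expansion: a bounded function is
    paired with an integrable wavelet, and two dominated convergences (in the truncation of the
    periodizing sums, then over scales) justify integrating term by term. Randomness enters only
    through [growth_ae] and [not_proportional_ae]; outside their exceptional sets the argument is
    deterministic. *)

Section row_norm.
Context {R : realType} {d : nat}.
Implicit Types x y : 'rV[R]_d.

Lemma row_norm_ge x m : `|x 0 m| <= `|x|.
Proof.
rewrite [leRHS]/Num.Def.normr /= mx_normrE.
by apply/bigmax_geP; right => /=; exists (0, m).
Qed.

Lemma row_norm_le x (c : R) :
  0 <= c -> (forall m, `|x 0 m| <= c) -> `|x| <= c.
Proof.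
move=> c0 xc; rewrite [leLHS]/Num.Def.normr /= mx_normrE.
by apply/bigmax_leP; split => // -[i j] _ /=; rewrite (ord1 i).
Qed.

End row_norm.

Section enumerations.
Variable T : countType.

Definition enum_upto (n : nat) : seq T := pmap pickle_inv (iota 0 n).

Lemma enum_upto_uniq n : uniq (enum_upto n).
Proof.
by apply: pmap_uniq; [exact: pickle_invK|exact: iota_uniq].
Qed.

Lemma mem_enum_upto n x : (x \in enum_upto n) = (pickle x < n)%N.
Proof.
rewrite mem_pmap; apply/mapP/idP => [[k]|xn].
  rewrite mem_iota /= add0n => kn xk.
  by have := @pickle_invK T k; rewrite -xk /= => ->.
by exists (pickle x); rewrite ?mem_iota//= pickleK_inv.
Qed.

Lemma enum_upto_sub (s : seq T) :
  exists N, forall n, (N <= n)%N -> {subset s <= enum_upto n}.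
Proof.
elim: s => [|x s [N HN]]; first by exists 0%N.
exists (maxn N (pickle x).+1) => n; rewrite geq_max => /andP[Nn xn] y.
rewrite inE => /predU1P[->|/HN]; first by rewrite mem_enum_upto.
exact.
Qed.

Lemma ler_sum_uniq_sub (R : numDomainType) (s t : seq T) (F : T -> R) :
  uniq s -> uniq t -> {subset s <= t} -> (forall x, 0 <= F x) ->
  \sum_(x <- s) F x <= \sum_(x <- t) F x.
Proof.
move=> us ut st F0.
have st' : perm_eq s [seq x <- t | x \in s].
  apply: uniq_perm => //; first by rewrite filter_uniq.
  by move=> x; rewrite mem_filter; apply/idP/andP => [xs|[]//]; split=> //; exact: st.
rewrite (perm_big _ st') big_filter [leRHS](bigID (mem s))/=.
by rewrite lerDl sumr_ge0.
Qed.

End enumerations.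

Section lattice_sum_theory.
Context {R : realType} {d : nat}.
Implicit Type F : 'rV[int]_d -> R.

Definition abs_sums_le F (M : R) :=
  forall s : seq 'rV[int]_d, uniq s -> \sum_(l <- s) `|F l| <= M.

(** Every finite set lies in some [enum_upto], so for nonnegative terms the supremum over finite
    sets is the limit along the exhaustion. *)
Lemma esum_cvg_enum_upto F (M : R) : (forall l, 0 <= F l) ->
  (forall s, uniq s -> \sum_(l <- s) F l <= M) ->
  \sum_(l <- enum_upto 'rV[int]_d n) F l @[n --> \oo] -->
    fine (\esum_(l in [set: 'rV[int]_d]) (F l)%:E)%E /\
  ((\esum_(l in [set: 'rV[int]_d]) (F l)%:E) \is a fin_num)%E.
Proof.
move=> F0 FM.
set u := fun n : nat => \sum_(l <- enum_upto 'rV[int]_d n) F l.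
have nd : nondecreasing_seq u.
  move=> m n mn; apply: ler_sum_uniq_sub => //; try exact: enum_upto_uniq.
  by move=> x; rewrite !mem_enum_upto => /leq_trans; exact.
have ub : has_ubound (range u).
  by exists M => _ [n _ <-]; apply: FM; exact: enum_upto_uniq.
have ucv := nondecreasing_cvgn nd ub.
have E : (\esum_(l in [set: 'rV[int]_d]) (F l)%:E = (sup (range u))%:E)%E.
  apply/eqP; rewrite eq_le; apply/andP; split.
    apply: ge_ereal_sup => _ [A [finA _] <-].
    rewrite fsbig_finite// sumEFin lee_fin.
    have [N HN] := enum_upto_sub (finmap.enum_fset (fset_set A)).
    apply: (@le_trans _ _ (u N)); last first.
      by apply: ub_le_sup => //; exists N.
    by apply: ler_sum_uniq_sub;
      [exact: finmap.fset_uniq|exact: enum_upto_uniq|exact: HN|].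
  rewrite -(cvg_lim _ ucv)//.
  apply: (@le_trans _ _ (limn (EFin \o u))%E); last first.
    apply: lime_le; first by apply/cvg_ex; eexists; apply: cvg_EFin ucv; near=> n.
    near=> n; rewrite /= /u -sumEFin fsbig_seq; last exact: enum_upto_uniq.
    apply: ereal_sup_ubound; exists [set` enum_upto 'rV[int]_d n] => //.
    by split => //; exact: finite_seq.
  rewrite (cvg_lim _ (cvg_EFin _ ucv))//; last by near=> n.
  by rewrite (cvg_lim _ ucv).
by rewrite E.
Unshelve. all: by end_near. Qed.

(** [fine] sends infinite values to 0, so [lattice_sum] is a genuine sum only when both parts are
    finite. The bound on finite absolute sums ensures this, and the two parts converge
    separately. *)
Lemma lattice_sum_cvg F (M : R) : abs_sums_le F M ->
  \sum_(l <- enum_upto 'rV[int]_d n) F l @[n --> \oo] --> lattice_sum F.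
Proof.
move=> FM.
have pF l : 0 <= Num.max (F l) 0 by rewrite le_max lexx orbT.
have nF l : 0 <= Num.max (- F l) 0 by rewrite le_max lexx orbT.
have pM s : uniq s -> \sum_(l <- s) Num.max (F l) 0 <= M.
  move=> us; apply: le_trans (FM s us); apply: ler_sum => l _.
  by rewrite ge_max ler_norm normr_ge0.
have nM s : uniq s -> \sum_(l <- s) Num.max (- F l) 0 <= M.
  move=> us; apply: le_trans (FM s us); apply: ler_sum => l _.
  by rewrite ge_max -normrN ler_norm normr_ge0.
have [pc pfin] := esum_cvg_enum_upto pF pM.
have [nc nfin] := esum_cvg_enum_upto nF nM.
have -> : lattice_sum F =
    fine (\esum_(l in [set: 'rV[int]_d]) (Num.max (F l) 0)%:E)%E -
    fine (\esum_(l in [set: 'rV[int]_d]) (Num.max (- F l) 0)%:E)%E.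
  rewrite /lattice_sum -fineB//; congr (fine (_ - _)%E);
    apply: eq_esum => l _ /=.
    by rewrite funeposE /= -EFin_max.
  by rewrite funenegE /= -EFin_max.
rewrite (_ : (fun n => _) = (fun n =>
    (\sum_(l <- enum_upto 'rV[int]_d n) Num.max (F l) 0) -
    (\sum_(l <- enum_upto 'rV[int]_d n) Num.max (- F l) 0))).
  exact: cvgB.
apply/funext => n; rewrite -sumrB; apply: eq_bigr => l _.
case: (leP 0 (F l)) => F0.
  by rewrite max_r ?oppr_le0// subr0.
by rewrite max_l ?oppr_ge0 ?ltW// opprK add0r.
Qed.

Lemma lattice_sum_shift F (l0 : 'rV[int]_d) :
  lattice_sum (fun l => F (l + l0)) = lattice_sum F.
Proof.
have bij : set_bij [set: 'rV[int]_d] [set: 'rV[int]_d] (fun l => l + l0).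
  split => //.
  - by move=> x y _ _; exact: addIr.
  - by move=> y _; exists (y - l0) => //; rewrite subrK.
rewrite /lattice_sum; congr (fine (_ - _)%E).
- rewrite (reindex_esum _ _ _ (EFin \o F)^\+%E bij).
  by apply: eq_esum => l _; rewrite !funeposE.
- rewrite (reindex_esum _ _ _ (EFin \o F)^\-%E bij).
  by apply: eq_esum => l _; rewrite !funenegE.
Qed.

End lattice_sum_theory.

(** * A weight with uniformly bounded lattice sums *)

Section weight.
Context {R : realType}.

(** The product form makes sums over Z^d and integrals over R^d factor into one-dimensional ones. *)
Definition weight d (x : 'rV[R]_d) : R := \prod_m (1 + x 0 m ^+ 2)^-1.

Lemma weight_ge0 d (x : 'rV[R]_d) : 0 <= weight x.
Proof.
by apply: prodr_ge0 => m _; rewrite invr_ge0 addr_ge0// sqr_ge0.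
Qed.

(** Each 1 + x_m^2 is at most (1 + |x|)^2; hence fast decay of order 2d gives domination by
    [weight]. *)
Lemma weight_ge d (x : 'rV[R]_d) : (1 + `|x|) ^- (2 * d) <= weight x.
Proof.
have -> : (1 + `|x|) ^- (2 * d) = \prod_(m < d) (1 + `|x|) ^- 2.
  by rewrite prodr_const card_ord exprM -exprVn.
apply: ler_prod => m _; rewrite invr_ge0 exprn_ge0 ?addr_ge0//=.
have h : 0 < 1 + x 0 m ^+ 2 by rewrite ltr_pwDl// sqr_ge0.
have h' : 0 < 1 + `|x| by rewrite ltr_pwDl.
rewrite lef_pV2 ?posrE ?exprn_gt0//.
have := row_norm_ge x m; rewrite -(ger0_norm (sqr_ge0 (x 0 m))) normrX.
have := normr_ge0 (x 0 m); move: `|x 0 m| `|x| => p q p0 pq.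
have : p ^+ 2 <= q ^+ 2 by rewrite lerXn2r// nnegrE// (le_trans p0).
nra.
Qed.


Lemma sum_inv_sq_le n : \sum_(0 <= i < n) (1 + i%:R ^+ 2)^-1 <= 4%:R :> R.
Proof.
(* Telescoping: 4 (1 + t^2) >= (t + 1)(t + 2), so the term at t is at most 4 (1/(t + 1) - 1/(t +
   2)). *)
suff : \sum_(0 <= i < n) (1 + i%:R ^+ 2)^-1 <= 4 * (1 - n.+1%:R^-1) :> R.
  move/le_trans; apply; rewrite -[leRHS]mulr1 ler_pM2l// gerBl invr_ge0.
elim: n => [|n IH]; first by rewrite big_nil invr1 subrr mulr0.
rewrite big_nat_recr//=; apply: (le_trans (lerD IH (lexx _))).
rewrite -[n.+2%:R]natr1 -[n.+1%:R]natr1.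
have : 0 <= n%:R :> R by [].
move: n%:R => t t0.
suff : (1 + t ^+ 2)^-1 <= 4 * ((t + 1)^-1 - (t + 1 + 1)^-1) by lra.
have -> : 4 * ((t + 1)^-1 - (t + 1 + 1)^-1) = (((t + 1) * (t + 2)) / 4)^-1.
  by field; rewrite !gt_eqF//; lra.
rewrite lef_pV2 ?posrE; nra.
Qed.

Lemma sum_inv_sq_centered_le (L : nat) :
  \sum_(i < L.*2.+1) (1 + (i%:Z - L%:Z)%:~R ^+ 2)^-1 <= 8%:R :> R.
Proof.
rewrite -(big_mkord xpredT (fun i => (1 + (i%:Z - L%:Z)%:~R ^+ 2)^-1)).
rewrite -addnn (big_cat_nat _ (n := L)) //=; last by rewrite leqW// leq_addl.
rewrite [8%:R](_ : _ = 4%:R + 4%:R); last by rewrite -natrD.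
apply: lerD.
  rewrite big_nat_rev /= add0n.
  apply: le_trans (sum_inv_sq_le L.+1); rewrite [leRHS]big_nat_recl//.
  apply: ler_wpDl; first by rewrite invr_ge0 addr_ge0// sqr_ge0.
  rewrite !big_nat; apply: ler_sum => i /= iL.
  have -> : (L - i.+1)%N%:Z - L%:Z = - i.+1%:Z by rewrite -subzn//; ring.
  by rewrite rmorphN sqrrN.
rewrite -{1}[L]add0n big_addn -addSn addnK.
apply: le_trans (sum_inv_sq_le L.+1).
by apply: ler_sum => i _; rewrite PoszD addrK.
Qed.

End weight.

Section weight_sums.
Context {R : realType} {d : nat}.

(** Since n - p = (n - t) + (t - p) with |t - p| <= 1, one has 1 + (n - p)^2 <= 3 + 2 (t - n)^2. *)
Lemma inv_sq_shift_le (t : R) (n p : int) : p = Num.floor t ->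
  (1 + (t - n%:~R) ^+ 2)^-1 <= 3%:R * (1 + (n - p)%:~R ^+ 2)^-1.
Proof.
move=> ->; set p' := Num.floor t.
have /andP[h1 h2] : p'%:~R <= t < (p' + 1)%:~R by exact: floor_itv.
rewrite intrD in h2; rewrite intrB.
move: (n%:~R : R) (p'%:~R : R) h1 h2 => u v h1 h2.
have e1 : 0 < 1 + (t - u) ^+ 2 by rewrite ltr_pwDl// sqr_ge0.
have e2 : 0 < 1 + (u - v) ^+ 2 by rewrite ltr_pwDl// sqr_ge0.
rewrite -div1r ler_pdivrMr// mulrAC ler_pdivlMr//.
have a1 : (t - v) ^+ 2 <= 1 by nra.
have a2 := sqr_ge0 (t - v + (t - u)).
have a3 := sqr_ge0 (t - u).
lra.
Qed.

(** Recentering at the integer part of x costs a factor 3 per coordinate. The finite list then sits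
    in a box of side 2L + 1, over which the sum of products is a product of one-dimensional sums,
    each at most 8. Hence 24 per coordinate, uniformly in x. *)
Lemma sum_weight_le (x : 'rV[R]_d) (s : seq 'rV[int]_d) : uniq s ->
  \sum_(k <- s) weight (x - intv k) <= 24%:R ^+ d.
Proof.
move=> us; pose p m := Num.floor (x 0 m).
pose q (k : 'rV[int]_d) m := k 0 m - p m.
pose L := \max_(k <- s) \max_(m < d) absz (q k m).
have HL k m : k \in s -> (absz (q k m) <= L)%N.
  move=> ks; apply: (@leq_trans (\max_(m < d) absz (q k m))%N).
    exact: (leq_bigmax m).
  exact: (leq_bigmax_seq k).
pose e (k : 'rV[int]_d) : {ffun 'I_d -> 'I_L.*2.+1} :=
  [ffun m => inord (absz (q k m + L%:Z))].
have eE k m : k \in s -> (e k m)%:Z = q k m + L%:Z.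
  move=> ks; have := HL k m ks; rewrite ffunE => h.
  by rewrite inordK; lia.
pose G (f : {ffun 'I_d -> 'I_L.*2.+1}) : R :=
  \prod_m (3%:R * (1 + ((f m)%:Z - L%:Z)%:~R ^+ 2)^-1).
have G0 f : 0 <= G f.
  by apply: prodr_ge0 => m _; rewrite mulr_ge0// invr_ge0 addr_ge0// sqr_ge0.
apply: (@le_trans _ _ (\sum_(k <- s) G (e k))).
  rewrite big_seq [leRHS]big_seq; apply: ler_sum => k ks.
  apply: ler_prod => m _; rewrite invr_ge0 addr_ge0 ?sqr_ge0//= !mxE eE//.
  by rewrite addrK; exact: inv_sq_shift_le.
rewrite -(big_map e xpredT G).
have ue : uniq (map e s).
  rewrite map_inj_in_uniq// => k k' ks k's ekk'.
  apply/rowP => m.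
  by have := eE k m ks; rewrite ekk' eE// => /addIr/addIr ->.
apply: (@le_trans _ _ (\sum_f G f)).
  rewrite big_uniq//= [leRHS](bigID (mem (map e s)))/= lerDl.
  by rewrite sumr_ge0.
rewrite -(bigA_distr_bigA (fun _ (i : 'I_L.*2.+1) =>
  3%:R * (1 + (i%:Z - L%:Z)%:~R ^+ 2)^-1 : R)).
rewrite -[d in leRHS]card_ord -prodr_const.
apply: ler_prod => m _; rewrite -mulr_sumr; apply/andP; split.
  rewrite mulr_ge0// sumr_ge0// => i _.
  by rewrite invr_ge0 addr_ge0// sqr_ge0.
by rewrite (_ : 24%:R = 3%:R * 8%:R) ?ler_pM2l ?sum_inv_sq_centered_le// -natrM.
Qed.

End weight_sums.

(** * Wavelets at a fixed scale *)

Section smooth_decay.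
Context {R : realType} {d : nat}.

(** The one-variable mean value theorem for t |-> g (z + t v). As b may have either sign, t is only
    located by |t| <= |b|. *)
Lemma mean_value_line (g : 'rV[R]_d -> R) (v z : 'rV[R]_d) (b : R) :
  (forall x, derivable g x v) ->
  exists2 t, `|t| <= `|b| & g (z + b *: v) - g z = b * 'D_v g (z + t *: v).
Proof.
move=> dg; pose h t := g (z + t *: v).
have E t : (fun s : R => s^-1 *: ((h \o shift t) (s *: (1 : R)) - h t)) =
    (fun s => s^-1 *: ((g \o shift (z + t *: v)) (s *: v) - g (z + t *: v))).
  apply/funext => s; rewrite /h /=; congr (_ *: (g _ - _)).
  by rewrite [s *: 1]mulr1 scalerDl addrCA.
have hd t : is_derive t (1 : R) h ('D_v g (z + t *: v)).
  apply: DeriveDef; rewrite /derivable /derive E //.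
  exact: dg.
have hc : continuous h.
  by move=> t; apply/differentiable_continuous/derivable1_diffP.
have hw (u w : R) : {within `[u, w], continuous h}.
  exact: continuous_subspaceT.
case: (leP 0 b) => b0.
  have [c] := MVT_segment b0 (fun t _ => hd t) (hw 0 b).
  rewrite in_itv /= => /andP[c0 cb]; rewrite /h scale0r addr0 subr0 => hE.
  by exists c; rewrite 1?mulrC// !ger0_norm.
have [c] := MVT_segment (ltW b0) (fun t _ => hd t) (hw b 0).
rewrite in_itv /= => /andP[bc c0]; rewrite /h scale0r addr0 sub0r => hE.
exists c; first by rewrite !ler0_norm ?lerN2// ltW.
by rewrite -opprB hE mulrN opprK mulrC.
Qed.

(* The second bound comes from the partial derivatives only, by moving one
   coordinate at a time: g itself is not assumed differentiable. *)
Definition decay_bound (D : R) (g : 'rV[R]_d -> R) :=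
  [/\ 0 <= D, forall x, `|g x| <= D * weight x &
  forall x y, `|x - y| <= 1 -> `|g x - g y| <= D * `|x - y| * weight x].

Lemma smooth_fast_decay_bound (g : 'rV[R]_d -> R) :
  smooth_fast_decay 1 g -> exists D, decay_bound D g.
Proof.
move=> [/(_ (2 * d)%N)[C0 hC0] hg].
have /choice[C hC] : forall m, exists C, forall x,
    `|'D_(delta_mx 0 m) g x| <= C / (1 + `|x|) ^+ (2 * d).
  by move=> m; have [_ [/(_ (2 * d)%N)]] := hg m.
have pos x : 0 < 1 + `|x| :> R by rewrite ltr_pwDl.
have posX (x : 'rV[R]_d) : 0 <= (1 + `|x|) ^- (2 * d).
  by rewrite invr_ge0 exprn_ge0// ltW.
(* The intermediate point p used below lies within 2 of x, so 1 + |x| <= 3 (1 + |p|): moving the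
   decay from p to x costs 3^(2d). *)
pose D := \sum_m `|C m| * 3 ^+ (2 * d).
have D0 : 0 <= D by rewrite sumr_ge0// => m _; rewrite mulr_ge0.
exists (`|C0| + D); split; first by rewrite addr_ge0.
  move=> x; apply: (le_trans (hC0 x)).
  apply: (@le_trans _ _ (`|C0| * (1 + `|x|) ^- (2 * d))).
    by rewrite ler_wpM2r// ler_norm.
  by apply: ler_pM; rewrite ?weight_ge ?lerDl.
move=> x y xy1.
pose z (k : nat) : 'rV[R]_d := \row_m (if (m < k)%N then x 0 m else y 0 m).
have zx : z d = x by apply/rowP => m; rewrite mxE ltn_ord.
have zy : z 0%N = y by apply/rowP => m; rewrite mxE.
have -> : g x - g y = \sum_(m < d) (g (z m.+1) - g (z m)).
  by rewrite -(big_mkord xpredT (fun m => g (z m.+1) - g (z m)))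
    telescope_sumr// zx zy.
apply: (le_trans (ler_norm_sum _ _ _)).
apply: (@le_trans _ _ (\sum_(m < d)
    `|x - y| * (`|C m| * 3 ^+ (2 * d) * (1 + `|x|) ^- (2 * d)))); last first.
  rewrite -mulr_sumr -mulr_suml mulrAC [leRHS]mulrC; apply: ler_wpM2l => //.
  by apply: ler_pM; rewrite ?weight_ge ?lerDr.
apply: ler_sum => m _.
pose v : 'rV[R]_d := delta_mx 0 m.
have zS : z m.+1 = z m + (x 0 m - y 0 m) *: v.
  apply/rowP => n; rewrite !mxE eqxx /= ltnS.
  have [->|nm] := eqVneq n m.
    by rewrite leqnn ltnn mulr1 addrC subrK.
  by rewrite mulr0 addr0 leq_eqVlt (negbTE nm : (n == m :> nat) = false).
have [t t1 ->] : exists2 t, `|t| <= `|x 0 m - y 0 m| &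
    g (z m.+1) - g (z m) = (x 0 m - y 0 m) * 'D_v g (z m + t *: v).
  rewrite zS; apply: mean_value_line; exact: (hg m).1.
have xym : `|x 0 m - y 0 m| <= `|x - y|.
  by have := row_norm_ge (x - y) m; rewrite !mxE.
rewrite normrM; apply: ler_pM => //.
apply: (le_trans (hC _ _)); set p := z m + t *: v.
apply: (@le_trans _ _ (`|C m| * (1 + `|p|) ^- (2 * d))).
  by rewrite ler_wpM2r// ler_norm.
rewrite -mulrA ler_wpM2l//.
rewrite ler_pdivlMr ?exprn_gt0// mulrC ler_pdivrMr ?exprn_gt0// -exprMn.
have pos' (u : 'rV[R]_d) : 0 <= 1 + `|u| by rewrite ltW.
rewrite lerXn2r ?nnegrE ?mulr_ge0//.
have : `|p - x| <= 2.
  apply: row_norm_le => // n; rewrite !mxE eqxx /=.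
  have xyn : `|x 0 n - y 0 n| <= 1.
    by apply: le_trans (xy1); have := row_norm_ge (x - y) n; rewrite !mxE.
  have [nm|nm] := eqVneq n m.
    rewrite nm ltnn mulr1 -nm addrAC; apply: (le_trans (ler_normD _ _)).
    rewrite distrC -[2](natrD _ 1 1); apply: lerD => //.
    by apply: (le_trans t1); rewrite -nm.
  rewrite mulr0 addr0; case: ifP => _; first by rewrite subrr normr0.
  by rewrite distrC (le_trans xyn)// ler1n.
have := lerB_dist x p; rewrite distrC.
by move: (normr_ge0 p) => h1 h2 h3; lra.
Qed.

End smooth_decay.

Lemma wavelet_types_gt0 d : (0 < d)%N -> (0 < (2 ^ d).-1)%N.
Proof. by move=> d0; rewrite -ltnS prednK ?expn_gt0// -{1}(expn0 2) ltn_exp2l. Qed.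

Section levels.
Context {R : realType} {d : nat}.
Variable Psi : 'I_((2 ^ d).-1) -> 'rV[R]_d -> R.

(* 2^j (x - l) - k = 2^j x - (k + 2^j l), and (k, l) |-> k + 2^j l is injective:
   a sum over k of periodized wavelets is a plain sum over the lattice. *)
Definition lattice_index (j : nat) (k : 'rV['I_(2 ^ j)]_d) (l : 'rV[int]_d) :
  'rV[int]_d := \row_m ((k 0 m : nat)%:Z + (2 ^ j)%N%:Z * l 0 m).

Lemma lattice_index_inj j (k k' : 'rV['I_(2 ^ j)]_d) l l' :
  lattice_index k l = lattice_index k' l' -> k = k' /\ l = l'.
Proof.
move=> /rowP E.
have H m : k 0 m = k' 0 m /\ l 0 m = l' 0 m.
  have := E m; rewrite !mxE => e.
  have p0 : (2 ^ j)%N%:Z != 0 by rewrite eqz_nat expn_eq0.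
  have kk : (k 0 m : nat) = k' 0 m.
    (* As 0 <= k_m < 2^j, the residue modulo 2^j recovers k. *)
    have := congr1 (fun z => (z %% (2 ^ j)%N%:Z)%Z) e.
    have lt (a : 'I_(2 ^ j)) : 0 <= a%:Z < (2 ^ j)%N%:Z by rewrite ltz_nat ltn_ord.
    rewrite /= ![_%:Z * _]mulrC ![_ + _ * _]addrC !modzMDl !modz_small ?lt//=.
    by case.
  split; first exact: (ord_inj kk).
  by move: e; rewrite kk => /addrI/(mulfI p0).
by split; apply/rowP => m; case: (H m).
Qed.

Lemma periodized_arg j (k : 'rV['I_(2 ^ j)]_d) (l : 'rV[int]_d) (x : 'rV[R]_d) :
  2 ^+ j *: (x - intv l) - \row_m (k 0 m : nat)%:R =
  2 ^+ j *: x - intv (lattice_index k l).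
Proof.
apply/rowP => m; rewrite !mxE intrD intrM mulrBr -addrA; congr (_ + _).
by rewrite opprD addrC -!pmulrn natrX.
Qed.

Definition level (c : torus_index d -> R) (j : nat) (x : 'rV[R]_d) : R :=
  \sum_(ik : 'I_((2 ^ d).-1) * 'rV['I_(2 ^ j)]_d)
    c (existT _ j ik) * periodized Psi (existT _ j ik) x.

(** Finite stand-in for [periodized], with the same range of l for every k: bounds are proved on it
    uniformly in n and pass to the limit. *)
Definition truncated_periodized (n : nat) (u : torus_index d) (x : 'rV[R]_d) : R :=
  let: existT j (i, k) := u in
  \sum_(l <- enum_upto 'rV[int]_d n) Psi i (2 ^+ j *: x - intv (lattice_index k l)).

Lemma periodized_shift (u : torus_index d) (x : 'rV[R]_d) (l0 : 'rV[int]_d) :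
  periodized Psi u (x + intv l0) = periodized Psi u x.
Proof.
case: u => j [i k]; rewrite /periodized.
rewrite -[RHS](lattice_sum_shift _ (- l0)); congr lattice_sum.
apply/funext => l; congr (Psi i (_ *: _ - _)).
by apply/rowP => m; rewrite !mxE intrD intrN; ring.
Qed.

(** Distinct pairs (k, l) give distinct lattice points, so the double sum is itself one of the
    finite sums bounded by M. *)
Lemma sum_lattice_index_le j (G : 'rV[int]_d -> R) (M : R) (s : seq 'rV[int]_d) :
  (forall s, uniq s -> \sum_(l <- s) G l <= M) -> uniq s ->
  \sum_(k : 'rV['I_(2 ^ j)]_d) \sum_(l <- s) G (lattice_index k l) <= M.
Proof.
move=> GM us; rewrite -big_enum /=.
have := GM [seq lattice_index k l | k <- enum 'rV['I_(2 ^ j)]_d, l <- s].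
rewrite big_allpairs_dep; apply.
apply: allpairs_uniq => //; first exact: enum_uniq.
by move=> [k l] [k' l'] _ _ /= /lattice_index_inj[-> ->].
Qed.

Variable D : R.
Hypothesis PsiD : forall i, decay_bound D (Psi i).

Let D0 (i : 'I_((2 ^ d).-1)) : 0 <= D. Proof. by case: (PsiD i). Qed.

Lemma sum_scaled_weight_le (i : 'I_((2 ^ d).-1)) (e : R) (x : 'rV[R]_d) s : 0 <= e ->
  uniq s -> \sum_(l <- s) (D * e * weight (x - intv l)) <= D * e * 24%:R ^+ d.
Proof.
move=> e0 us; rewrite -mulr_sumr ler_wpM2l//; last exact: sum_weight_le.
by rewrite mulr_ge0// D0.
Qed.

Lemma truncated_periodized_cvg (u : torus_index d) (x : 'rV[R]_d) :
  truncated_periodized n u x @[n --> \oo] --> periodized Psi u x.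
Proof.
case: u => j [i k]; rewrite /truncated_periodized /periodized.
under eq_fun do under eq_bigr do rewrite -periodized_arg.
apply: (@lattice_sum_cvg _ _ _ (D * 1 * 24 ^+ d)) => s us.
under eq_bigr do rewrite periodized_arg.
rewrite -(big_map (lattice_index k) xpredT (fun l => `|Psi i (2 ^+ j *: x - intv l)|)).
have us' : uniq (map (lattice_index k) s).
  by rewrite map_inj_uniq// => l l' /lattice_index_inj[].
apply: le_trans (sum_scaled_weight_le i (2 ^+ j *: x) ler01 us').
by apply: ler_sum => l _; rewrite mulr1; have [_ h _] := PsiD i; exact: h.
Qed.

(** The 2^(jd) translates at scale j are absorbed by a lattice sum of weights independent of j; only
    the number of wavelet types remains as a factor. *)
Definition level_const : R := (2 ^ d).-1%:R * (D * 24 ^+ d).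

Section level_bounds.
Variables (c : torus_index d -> R) (j : nat) (A : R).
Hypothesis cA : forall ik, `|c (existT _ j ik)| <= A.

(** Used with e = 1 for the size of a level and with e = 2^j |x - y| for its increments. *)
Lemma level_sum_le (e : R) (x : 'rV[R]_d) (n : nat)
    (H : 'I_((2 ^ d).-1) -> 'rV[int]_d -> R) : 0 <= e ->
  (forall i l, `|H i l| <= D * e * weight (2 ^+ j *: x - intv l)) ->
  `|\sum_(ik : 'I_((2 ^ d).-1) * 'rV['I_(2 ^ j)]_d) c (existT _ j ik) *
     \sum_(l <- enum_upto 'rV[int]_d n) H ik.1 (lattice_index ik.2 l)|
  <= A * level_const * e.
Proof.
move=> e0 He; apply: (le_trans (ler_norm_sum _ _ _)).
apply: (@le_trans _ _ (\sum_(ik : 'I_((2 ^ d).-1) * 'rV['I_(2 ^ j)]_d)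
    A * \sum_(l <- enum_upto 'rV[int]_d n)
      (D * e * weight (2 ^+ j *: x - intv (lattice_index ik.2 l))))).
  apply: ler_sum => ik _; rewrite normrM; apply: ler_pM => //.
  apply: (le_trans (ler_norm_sum _ _ _)); exact: ler_sum.
rewrite -mulr_sumr -(pair_bigA _ (fun i k => \sum_(l <- enum_upto 'rV[int]_d n)
      (D * e * weight (2 ^+ j *: x - intv (lattice_index k l)))))/=.
(* Without wavelet types (d = 0) the sum is empty; otherwise A >= 0 follows from [cA] at one
   index. *)
case: (posnP (2 ^ d).-1) => [I0|Ipos].
  rewrite /level_const big1 ?I0 ?mul0r ?mulr0 ?mul0r// => i _.
  by have := ltn_ord i.
have A0 : 0 <= A.
  apply: le_trans (cA (Ordinal Ipos, \row_m Ordinal (_ : 0 < 2 ^ j)%N)) => //.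
  by rewrite expn_gt0.
rewrite -mulrA ler_wpM2l// /level_const -mulrA.
rewrite -[X in X%:R * _]card_ord mulr_natl -sumr_const.
apply: ler_sum => i _.
rewrite [leRHS](_ : _ = D * e * 24 ^+ d); last by ring.
apply: (@sum_lattice_index_le j (fun l => D * e * weight (2 ^+ j *: x - intv l)));
  last exact: enum_upto_uniq.
by move=> s; exact: (sum_scaled_weight_le i).
Qed.

Lemma truncated_level_le n x :
  `|\sum_(ik : 'I_((2 ^ d).-1) * 'rV['I_(2 ^ j)]_d)
     c (existT _ j ik) * truncated_periodized n (existT _ j ik) x|
  <= A * level_const.
Proof.
rewrite -[leRHS]mulr1.
rewrite (eq_bigr (fun ik : 'I_((2 ^ d).-1) * 'rV['I_(2 ^ j)]_d =>
  c (existT _ j ik) * \sum_(l <- enum_upto 'rV[int]_d n)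
    (fun i l => Psi i (2 ^+ j *: x - intv l)) ik.1 (lattice_index ik.2 l))).
  apply: (@level_sum_le 1 x n (fun i l => Psi i (2 ^+ j *: x - intv l))) => // i l.
  rewrite mulr1.
  by have [_ h _] := PsiD i; exact: h.
by move=> [i k] _.
Qed.

Lemma truncated_level_cvg x :
  \sum_(ik : 'I_((2 ^ d).-1) * 'rV['I_(2 ^ j)]_d)
     c (existT _ j ik) * truncated_periodized n (existT _ j ik) x
  @[n --> \oo] --> level c j x.
Proof.
apply: cvg_big => [|ik _]; first exact: add_continuous.
apply: cvgMl_tmp.
exact: truncated_periodized_cvg.
Qed.

Lemma level_le x : `|level c j x| <= A * level_const.
Proof.
apply: cvgr_to_le (cvg_norm (@truncated_level_cvg x)) _.
by near=> n; exact: truncated_level_le.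
Unshelve. all: by end_near. Qed.

Lemma level_sub_le x y : 2 ^+ j * `|x - y| <= 1 ->
  `|level c j x - level c j y| <= A * level_const * (2 ^+ j * `|x - y|).
Proof.
move=> xy1.
apply: cvgr_to_le
  (cvg_norm (cvgB (@truncated_level_cvg x) (@truncated_level_cvg y))) _.
near=> n; rewrite fctE -sumrB.
rewrite (eq_bigr (fun ik : 'I_((2 ^ d).-1) * 'rV['I_(2 ^ j)]_d =>
  c (existT _ j ik) * \sum_(l <- enum_upto 'rV[int]_d n)
    (fun i l => Psi i (2 ^+ j *: x - intv l) - Psi i (2 ^+ j *: y - intv l))
    ik.1 (lattice_index ik.2 l))).
  apply: (@level_sum_le _ x n (fun i l => Psi i (2 ^+ j *: x - intv l) -
    Psi i (2 ^+ j *: y - intv l))) => // i l.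
  have E : `|2 ^+ j *: x - intv l - (2 ^+ j *: y - intv l)| = 2 ^+ j * `|x - y|.
    rewrite opprB addrA subrK -scalerBr mx_normZ ger0_norm//.
  have [_ _ h] := PsiD i.
  by rewrite -E; apply: h; rewrite E.
by move=> [i k] _; rewrite -mulrBr sumrB.
Unshelve. all: by end_near. Qed.

End level_bounds.

Lemma level_shift c j (x : 'rV[R]_d) (l : 'rV[int]_d) :
  level c j (x + intv l) = level c j x.
Proof. by apply: eq_bigr => ik _; rewrite periodized_shift. Qed.

End levels.

(** * Regularity of the randomized series *)

Section polynomial_geometric.
Context {R : realType}.

Lemma sum_geometric_le (q : R) n : 0 <= q -> q < 1 ->
  \sum_(0 <= i < n) q ^+ i <= (1 - q)^-1.
Proof.
move=> q0 q1; have q1' : 0 < 1 - q by rewrite subr_gt0.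
rewrite -div1r ler_pdivlMr//.
suff -> : (\sum_(0 <= i < n) q ^+ i) * (1 - q) = 1 - q ^+ n.
  by rewrite gerBl exprn_ge0.
elim: n => [|n IH]; first by rewrite big_nil mul0r expr0 subrr.
by rewrite big_nat_recr//= mulrDl IH exprS; ring.
Qed.

(** This is ln u <= u - 1 at u = e x; the free parameter e makes the exponential rate p e as small
    as desired. *)
Lemma powR_le_expR (p e x : R) : 0 <= p -> 0 < e -> 0 < x ->
  x `^ p <= expR (- p * (1 + ln e)) * expR (p * e * x).
Proof.
move=> p0 e0 x0; rewrite -expRD /powR gt_eqF// ler_expR.
have : ln (1 + (e * x - 1)) <= e * x - 1.
  by apply: le_ln1Dx; rewrite ltrBrDl subrr mulr_gt0.
rewrite addrC subrK lnM ?posrE// => h.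
suff : p * (ln e + ln x) <= p * (e * x - 1) by lra.
exact: ler_wpM2l.
Qed.

Lemma sum_geometric_powR_bounded (q p : R) : 0 < q -> q < 1 -> 0 <= p ->
  exists2 B, 0 <= B & forall n, \sum_(0 <= i < n) q ^+ i * i.+1%:R `^ p <= B.
Proof.
(* t is the midpoint of 1 and 1/q: the power of i + 1 is absorbed into t^(i+1), and q t stays below
   1. *)
move=> q0 q1 p0; pose t := (1 + q^-1) / 2.
have t1 : 1 < t.
  have : 1 < q^-1 by rewrite invf_gt1.
  by rewrite /t; lra.
have t0 : 0 < t by apply: lt_trans t1.
have lt0 : 0 < ln t by rewrite ln_gt0.
(* Dividing by p + 1 instead of p gives p e <= ln t and covers p = 0. *)
pose e := ln t / (p + 1).
have p1 : 0 < p + 1 by rewrite ltr_wpDl.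
have e0 : 0 < e by rewrite divr_gt0.
have pe : p * e <= ln t.
  by rewrite /e mulrA ler_pdivrMr// mulrC ler_pM2l// lerDl.
pose K := expR (- p * (1 + ln e)).
have K0 : 0 <= K by exact: expR_ge0.
have qt0 : 0 <= q * t by rewrite mulr_ge0// ltW.
have qt1 : q * t < 1.
  by rewrite /t mulrA ltr_pdivrMr// mulrDr mulr1 divff ?gt_eqF//; lra.
exists (K * t * (1 - q * t)^-1).
  by rewrite mulr_ge0 ?invr_ge0 ?subr_ge0 ?(ltW qt1)// mulr_ge0// ltW.
move=> n; apply: (@le_trans _ _ (\sum_(0 <= i < n) K * t * (q * t) ^+ i)).
  apply: ler_sum => i _.
  have : i.+1%:R `^ p <= K * t ^+ i.+1.
    apply: (le_trans (powR_le_expR p0 e0 _)) => //; rewrite ler_wpM2l//.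
    rewrite -[t in leRHS]lnK ?posrE// -expRM_natl ler_expR.
    by rewrite mulrC ler_wpM2l.
  move=> /(ler_wpM2l (exprn_ge0 i (ltW q0)))/le_trans; apply.
  rewrite [(q * t) ^+ i]exprMn [t ^+ i.+1]exprS le_eqVlt.
  by apply/orP; left; apply/eqP; ring.
rewrite -mulr_sumr ler_wpM2l//; first by rewrite mulr_ge0// ltW.
exact: sum_geometric_le.
Qed.

(** J is the largest exponent with 2^J delta <= 1. Its positivity, due to delta <= 1/2, later allows
    J + 1 <= 2 J. *)
Lemma dyadic_scale (delta : R) : 0 < delta -> delta <= 2^-1 ->
  exists J : nat, [/\ (0 < J)%N, 2 ^+ J * delta <= 1 & 1 < 2 ^+ J.+1 * delta].
Proof.
move=> d0 d1.
have ex : exists n : nat, 1 < 2 ^+ n.+1 * delta.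
  exists (Num.truncn delta^-1).+1.
  rewrite -ltr_pdivrMr// div1r; apply: (lt_trans (truncnS_gt _)).
  rewrite -natrX ltr_nat; apply: ltnW; exact: ltn_expl.
case: (ex_minnP ex) => J hJ Jmin; exists J; split => //.
  case: J hJ {Jmin} => // ; rewrite expr1 => h.
  have : 2 * delta <= 1 by lra.
  by rewrite leNgt h.
case: J hJ Jmin => [|J] hJ Jmin; first by rewrite mul1r; lra.
rewrite leNgt; apply/negP => /Jmin; by rewrite ltnn.
Qed.

End polynomial_geometric.

Section torus_distance.
Context {R : realType} {d : nat}.

(** Rounding every coordinate of x - y to a nearest integer minimizes all coordinates at once, hence
    their maximum: the rounded integer is within 1/2, and any other integer is at distance at least
    1 from it. *)
Lemma torus_dist_attained (x y : 'rV[R]_d) : exists l : 'rV[int]_d,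
  torus_dist x y = `|x - y - intv l| /\ torus_dist x y <= 2^-1.
Proof.
pose l : 'rV[int]_d := \row_m Num.floor (x 0 m - y 0 m + 2^-1).
have hl m : `|(x - y - intv l) 0 m| <= 2^-1.
  rewrite !mxE.
  have := floor_itv (x 0 m - y 0 m + 2^-1).
  move: (Num.floor _) => z; rewrite intrD => /andP[h1 h2].
  by rewrite ler_norml; lra.
have l2 : `|x - y - intv l| <= 2^-1 by apply: row_norm_le => //; rewrite invr_ge0.
have lmin l' : `|x - y - intv l| <= `|x - y - intv l'|.
  apply: row_norm_le => // m; apply: le_trans (row_norm_ge _ m).
  have := hl m; rewrite !mxE; set t := x 0 m - y 0 m; set n := Num.floor _ => h.
  have [->//|nm] := eqVneq (l' 0 m) n.
  have : 1 <= `|(n - l' 0 m)%:~R : R|.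
    by rewrite -intr_norm ler1z; move: nm; lia.
  rewrite intrB => h1; have := ler_distD t n%:~R (l' 0 m)%:~R.
  rewrite [`|n%:~R - t|]distrC; lra.
exists l.
suff -> : torus_dist x y = `|x - y - intv l| by [].
apply/eqP; rewrite eq_le; apply/andP; split.
  by apply: ge_inf; [exists 0 => _ [l' _ <-]|exists l].
apply: lb_le_inf; first by exists `|x - y - intv l|, l.
by move=> _ [l' _ <-].
Qed.

Lemma torus_dist_gt0 (x y : 'rV[R]_d) : ~ same_point x y -> 0 < torus_dist x y.
Proof.
move=> xy; have [l [-> _]] := torus_dist_attained x y.
rewrite normr_gt0; apply/eqP => /subr0_eq e; apply: xy; by exists l.
Qed.

End torus_distance.

Section holder_bound.
Context {R : realType} {d : nat}.
Variables (Psi : 'I_((2 ^ d).-1) -> 'rV[R]_d -> R) (D : R).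
Hypothesis d_gt0 : (0 < d)%N.
Hypothesis PsiD : forall i, decay_bound D (Psi i).
Variables (alpha p A : R) (c : torus_index d -> R).
Hypotheses (alpha_gt0 : 0 < alpha) (alpha_lt1 : alpha < 1) (p_ge0 : 0 <= p).
Hypothesis A_ge0 : 0 <= A.
Hypothesis cA : forall u,
  `|c u| <= A * (2 `^ (- (alpha * (tag u)%:R)) * (tag u).+1%:R `^ p).

Local Notation r := (2 `^ (- alpha) : R).
Local Notation q := (2 `^ (- (1 - alpha)) : R).
Local Notation X := (wavelet_series Psi c).
Local Notation K := (A * @level_const R d D).

Lemma pow2_lt1 (s : R) : 0 < s -> 2 `^ (- s) < 1 :> R.
Proof.
move=> s0; rewrite powRN invf_lt1 ?powR_gt0// /powR gt_eqF// expR_gt1.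
by rewrite mulr_gt0// ln_gt0// ltr1n.
Qed.

Let r0 : 0 < r. Proof. exact: powR_gt0. Qed.
Let q0 : 0 < q. Proof. exact: powR_gt0. Qed.
Let r1 : r < 1. Proof. exact: pow2_lt1. Qed.
Let q1 : q < 1. Proof. by apply: pow2_lt1; rewrite subr_gt0. Qed.

Lemma pow2_natE (s : R) (n : nat) : 2 `^ (- (s * n%:R)) = (2 `^ (- s)) ^+ n :> R.
Proof. by rewrite -powR_mulrn ?powR_ge0// -powRrM mulNr. Qed.

Let D_ge0 : 0 <= D.
Proof.
by case: (PsiD (Ordinal (wavelet_types_gt0 d_gt0))).
Qed.

Let K_ge0 : 0 <= K.
Proof. by rewrite !mulr_ge0. Qed.

Let cAj j ik : `|c (existT _ j ik)| <= A * (r ^+ j * j.+1%:R `^ p).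
Proof. by rewrite -pow2_natE; exact: cA. Qed.

Let level_leK j x : `|level Psi c j x| <= K * (r ^+ j * j.+1%:R `^ p).
Proof.
by apply: (le_trans (level_le PsiD (@cAj j) x)); rewrite mulrAC.
Qed.

Lemma wavelet_partial_sums_cvg (x : 'rV[R]_d) : cvgn (wavelet_partial_sums Psi c x).
Proof.
have [B B0 HB] := sum_geometric_powR_bounded r0 r1 p_ge0.
apply: normed_cvg; apply: nondecreasing_is_cvgn.
  apply: nondecreasing_series => n _ _ /=. exact: normr_ge0.
exists (K * B) => _ [n _ <-]; apply: le_trans (ler_wpM2l K_ge0 (HB n)).
by rewrite /series /= mulr_sumr; apply: ler_sum => i _; exact: level_leK.
Qed.

Lemma partial_sums_le x n : `|wavelet_partial_sums Psi c x n| <=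
  \sum_(0 <= j < n) K * (r ^+ j * j.+1%:R `^ p).
Proof.
apply: (le_trans (ler_norm_sum _ _ _)); apply: ler_sum => i _; exact: level_leK.
Qed.

Lemma wavelet_series_shift (x : 'rV[R]_d) (l : 'rV[int]_d) : X (x + intv l) = X x.
Proof.
congr (limn _); apply/funext => n; apply: eq_bigr => j _; exact: level_shift.
Qed.

(** Coarse scales. With e = |x - y|, 2^(-alpha j) 2^j e = e^alpha (2^j e)^(1 - alpha), and 2^j e <=
    2^(-(J - j)). Since alpha < 1, this decays geometrically away from j = J. *)
Lemma level_sub_le_small j (x y : 'rV[R]_d) (J : nat) : (j <= J)%N -> 0 < `|x - y| ->
  2 ^+ J * `|x - y| <= 1 ->
  `|level Psi c j x - level Psi c j y| <=
  K * (`|x - y| `^ alpha * J.+1%:R `^ p) * q ^+ (J - j).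
Proof.
move=> jJ; set e := `|x - y| => e0 Je.
have je : 2 ^+ j * e <= 1.
  apply: le_trans Je; rewrite ler_pM2r// ler_eXn2l// ltr1n//.
apply: (le_trans (level_sub_le PsiD (@cAj j) je)).
have -> : A * (r ^+ j * j.+1%:R `^ p) * @level_const R d D * (2 ^+ j * e) =
    K * (j.+1%:R `^ p * (r ^+ j * (2 ^+ j * e))) by ring.
rewrite -[leRHS]mulrA ler_wpM2l// [e `^ _ * _]mulrC -mulrA.
apply: ler_pM; rewrite ?mulr_ge0 ?exprn_ge0 ?powR_ge0 ?(ltW e0)//.
  by apply: ge0_ler_powR; rewrite ?nnegrE// ler_nat.
have E : r ^+ j * (2 ^+ j * e) = e `^ alpha * (2 ^+ j * e) `^ (1 - alpha).
  rewrite powRM ?exprn_ge0 ?ltW// mulrCA.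
  have -> : e `^ alpha * ((2 ^+ j) `^ (1 - alpha) * e `^ (1 - alpha)) =
     (2 ^+ j) `^ (1 - alpha) * (e `^ alpha * e `^ (1 - alpha)) by ring.
  rewrite -powRD; last by rewrite (gt_eqF e0) implybT.
  rewrite addrCA subrr addr0 powRr1 ?ltW// mulrA; congr (_ * _).
  rewrite -powR_mulrn ?powR_ge0// -powRrM -powR_mulrn// -powRD; last first.
    by rewrite pnatr_eq0 implybT.
  by rewrite -powRrM; congr (_ `^ _); ring.
rewrite E ler_wpM2l ?powR_ge0//.
rewrite -powR_mulrn ?powR_ge0// -powRrM mulNr [_ * (J - j)%:R]mulrC -mulrN.
have -> : 2 `^ ((J - j)%:R * - (1 - alpha)) = (2 ^- (J - j)) `^ (1 - alpha) :> R.
  by rewrite mulrN -mulNr powRrM; congr (_ `^ _); rewrite powRN powR_mulrn.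
apply: ge0_ler_powR; rewrite ?nnegrE ?subr_ge0 ?invr_ge0 ?mulr_ge0 ?exprn_ge0
  ?(ltW e0) ?(ltW alpha_lt1)//.
rewrite -[leRHS]mulr1 ler_pdivlMl ?exprn_gt0//.
by rewrite mulrA -exprD subnK.
Qed.

(** Fine scales: the two values are bounded separately. With e = |x - y|, 2^(J+1) e > 1 gives
    r^(J+1) <= e^alpha. The 4 is 2 for the two values times 2 from r^J <= 2 r^(J+1), and j + J + 2
    <= (J + 1)(j + 2) splits the logarithmic factor. *)
Lemma level_sub_le_large j (x y : 'rV[R]_d) (J : nat) : 0 < `|x - y| ->
  1 < 2 ^+ J.+1 * `|x - y| ->
  `|level Psi c (j.+1 + J) x - level Psi c (j.+1 + J) y| <=
  K * (`|x - y| `^ alpha * J.+1%:R `^ p) * (4 * (r ^+ j.+1 * j.+2%:R `^ p)).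
Proof.
set e := `|x - y| => e0 Je.
apply: (le_trans (ler_normB _ _)).
apply: (le_trans (lerD (level_leK _ x) (level_leK _ y))).
have -> : K * (e `^ alpha * J.+1%:R `^ p) * (4 * (r ^+ j.+1 * j.+2%:R `^ p)) =
  K * (r ^+ j.+1 * (2 * e `^ alpha) * (J.+1%:R `^ p * j.+2%:R `^ p)) +
  K * (r ^+ j.+1 * (2 * e `^ alpha) * (J.+1%:R `^ p * j.+2%:R `^ p)) by ring.
suff h : r ^+ (j.+1 + J) * (j.+1 + J).+1%:R `^ p <=
    r ^+ j.+1 * (2 * e `^ alpha) * (J.+1%:R `^ p * j.+2%:R `^ p).
  by apply: lerD; rewrite ler_wpM2l.
apply: ler_pM; rewrite ?mulr_ge0 ?exprn_ge0 ?powR_ge0//.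
  rewrite exprD ler_wpM2l ?exprn_ge0 ?powR_ge0//.
  have h2 : r ^+ J.+1 <= e `^ alpha.
    rewrite -powR_mulrn ?powR_ge0// -powRrM mulNr mulrC -mulNr powRrM.
    apply: ge0_ler_powR; rewrite ?nnegrE ?powR_ge0 ?(ltW e0) ?(ltW alpha_gt0)//.
    by rewrite powRN powR_mulrn// -[leLHS]mul1r ler_pdivrMr ?exprn_gt0// mulrC ltW.
  have h3 : 1 <= 2 * r.
    rewrite powRN ler_pdivlMr ?powR_gt0// mul1r.
    by rewrite ler1_powR ?ler1n// ltW.
  apply: (@le_trans _ _ (2 * r * r ^+ J)).
    by rewrite ler_peMl// exprn_ge0 ?powR_ge0.
  by rewrite -mulrA -exprS ler_wpM2l.
rewrite -powRM//; apply: ge0_ler_powR; rewrite ?nnegrE ?mulr_ge0//.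
by rewrite -natrM ler_nat mulSn -addSn leq_add2l leq_pmulr.
Qed.

Lemma wavelet_series_sub_le : exists2 H, 0 <= H &
  forall x y : 'rV[R]_d, 0 < `|x - y| -> `|x - y| <= 2^-1 ->
  `|X x - X y| <= H * (`|x - y| `^ alpha * `|ln `|x - y| | `^ p).
Proof.
have [B B0 HB] := sum_geometric_powR_bounded r0 r1 p_ge0.
pose B' : R := (1 - q)^-1 + 4 * B.
have B'0 : 0 <= B' by rewrite addr_ge0 ?mulr_ge0// invr_ge0 subr_ge0 ltW.
have ln2 : 0 < ln 2 :> R by rewrite ln_gt0// ltr1n.
have l2 : 0 <= 2 / ln 2 :> R by rewrite divr_ge0// ltW.
exists (K * B' * (2 / ln 2) `^ p); first by rewrite !mulr_ge0// powR_ge0.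
move=> x y; set e := `|x - y| => e0 e1.
have [J [J0 Je eJ]] := dyadic_scale e0 e1.
(* J ln 2 <= - ln e and J + 1 <= 2 J give the constant 2 / ln 2. *)
have lnE : J.+1%:R <= 2 / ln 2 * `|ln e|.
  have lne : J%:R * ln 2 <= - ln e.
    rewrite -lnV ?posrE// mulrC mulr_natr -lnXn// ler_ln ?posrE ?exprn_gt0 ?invr_gt0//.
    by rewrite -[leRHS]mul1r ler_pdivlMr.
  apply: (@le_trans _ _ (2 / ln 2 * (- ln e))); last first.
    by rewrite ler_wpM2l// -normrN ler_norm.
  apply: (@le_trans _ _ (2 / ln 2 * (J%:R * ln 2))); last first.
    by rewrite ler_wpM2l.
  have -> : 2 / ln 2 * (J%:R * ln 2) = 2 * J%:R :> R by field; rewrite gt_eqF.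
  by rewrite -natrM ler_nat mul2n -addnn -addn1 leq_add2l.
apply: (@le_trans _ _ (K * (e `^ alpha * J.+1%:R `^ p) * B')); last first.
  have -> : K * B' * (2 / ln 2) `^ p * (e `^ alpha * `|ln e| `^ p) =
    K * B' * e `^ alpha * ((2 / ln 2) `^ p * `|ln e| `^ p) by ring.
  have -> : K * (e `^ alpha * J.+1%:R `^ p) * B' =
    K * B' * e `^ alpha * J.+1%:R `^ p by ring.
  rewrite ler_wpM2l ?mulr_ge0 ?powR_ge0// -powRM//.
  by apply: ge0_ler_powR; rewrite ?nnegrE// mulr_ge0.
apply: cvgr_to_le
  (cvg_norm (cvgB (@wavelet_partial_sums_cvg x) (@wavelet_partial_sums_cvg y))) _.
near=> n; rewrite fctE /wavelet_partial_sums /series -sumrB.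
apply: (le_trans (ler_norm_sum _ _ _)).
(* Extending the sum by nonnegative terms puts the cutoff J inside the range for every n. *)
apply: (@le_trans _ _ (\sum_(0 <= j < J.+1 + n)
    `|level Psi c j x - level Psi c j y|)).
  by rewrite [leRHS](big_cat_nat _ (n := n))//= ?leq_addl// lerDl sumr_ge0.
rewrite (big_cat_nat _ (n := J.+1))//= ?leq_addr// /B' mulrDr.
have C0 : 0 <= K * (e `^ alpha * J.+1%:R `^ p) by rewrite !mulr_ge0 ?powR_ge0.
apply: lerD.
  apply: (@le_trans _ _ (\sum_(0 <= j < J.+1)
    K * (e `^ alpha * J.+1%:R `^ p) * q ^+ (J - j))).
    rewrite !big_nat; apply: ler_sum => j /= jJ; exact: level_sub_le_small.
  rewrite -mulr_sumr ler_wpM2l// big_nat_rev /= add0n.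
  apply: le_trans (sum_geometric_le J.+1 (ltW q0) q1).
  rewrite !big_nat; apply: ler_sum => j /= jJ.
  by rewrite subSS subKn.
rewrite -{1}[J.+1]add0n big_addn addKn.
apply: (@le_trans _ _ (\sum_(0 <= j < n)
    K * (e `^ alpha * J.+1%:R `^ p) * (4 * (r ^+ j.+1 * j.+2%:R `^ p)))).
  by apply: ler_sum => j _; rewrite -addSnnS; exact: level_sub_le_large.
rewrite -!mulr_sumr ler_wpM2l// ler_wpM2l//.
apply: le_trans (HB n.+1); rewrite [leRHS]big_nat_recl// lerDr.
by rewrite mulr_ge0 ?powR_ge0.
Unshelve. all: by end_near. Qed.

End holder_bound.

(** * Integration on R^d *)

Section lebesgue_Rd_theory.
Context {R : realType}.
Local Open Scope ereal_scope.

Definition cube d (n : nat) : set (d.-tuple (measurableTypeR R)) :=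
  [set t | forall m, (`|tnth t m : R| <= n%:R)%R].

Lemma measurable_cube d n : measurable (@cube d n).
Proof.
have -> : @cube d n = \bigcap_(m in [set: 'I_d])
    ((@tnth d (measurableTypeR R))^~ m @^-1` [set x : R | (`|x| <= n%:R)%R]).
  by apply/seteqP; split => [t h m _|t h m]; [exact: h|exact: (h m)].
apply: fin_bigcap_measurable => [|m _]; first exact: finite_finset.
rewrite -[X in measurable X]setTI.
apply: measurable_tnth => //.
have -> : [set x : R | (`|x| <= n%:R)%R] = `[(- n%:R)%R, n%:R%R]%classic.
  by apply/seteqP; split => x /=; rewrite in_itv /= ler_norml.
exact: measurable_itv.
Qed.

Lemma tcons_cube d n :
  @tcons R d @^-1` (@cube d.+1 n) = @cube d n `*` `[(- n%:R)%R, n%:R%R]%classic.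
Proof.
apply/seteqP; split => -[t a] /=.
  move=> h; split => /=.
    by move=> m; have := h (lift ord0 m); rewrite tnthS.
  by have := h ord0; rewrite in_itv /= -ler_norml.
move=> [h]; rewrite /= in_itv /= -ler_norml => ha m.
by case: (unliftP ord0 m) => [m' ->|->]; rewrite ?tnthS.
Qed.

Lemma lebesgue_Rd_cube_lty d n : lebesgue_Rd R d (@cube d n) < +oo.
Proof.
elim: d => [|d IH] /=.
  by rewrite diracE ltry.
rewrite /pushforward tcons_cube product_measure1E//; last exact: measurable_cube.
have h : lebesgue_measure (`[(- n%:R)%R, n%:R%R]%classic : set R) < +oo.
  by rewrite lebesgue_measure_itv/=; case: ifP => _; rewrite ?ltry// -EFinD ltry.
by apply: lte_mul_pinfty => //; rewrite ge0_fin_numE.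
Qed.

Lemma lebesgue_Rd_sigma_finite d : sigma_finite setT (lebesgue_Rd R d).
Proof.
exists (@cube d) => [|n].
  apply/seteqP; split => // t _.
  pose M := (\sum_(m < d) `|tnth t m : R|)%R.
  exists (Num.truncn M).+1 => // m.
  apply: (@le_trans _ _ M); last exact/ltW/truncnS_gt.
  by rewrite /M (bigD1 m)//= lerDl sumr_ge0.
by split; [exact: measurable_cube|exact: lebesgue_Rd_cube_lty].
Qed.

(** Tonelli's theorem expects a bundled sigma-finite measure, while [lebesgue_Rd] is built by
    recursion as a plain measure; the structure is recovered from a proof. *)
Lemma sigma_finite_measure_pack d (T : measurableType d)
    (m : {measure set T -> \bar R}) : sigma_finite setT m ->
  exists m' : {sigma_finite_measure set T -> \bar R}, m = m'.
Proof.
move=> h; pose H1 := isSFinite.Build _ _ _ _ (sfinite_measure_sigma_finite h).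
pose H2 := isSigmaFinite.Build _ _ _ _ h.
pose m' := HB.pack_for (SigmaFiniteMeasure.type T R) (Measure.sort m) H1 H2.
by exists m'; apply: eq_measure.
Qed.

End lebesgue_Rd_theory.

Section weight_integrable.
Context {R : realType}.

Lemma weight_rvE d (t : d.-tuple (measurableTypeR R)) :
  weight (rv t) = \prod_m (oneDsqr (tnth t m : R))^-1.
Proof. by apply: eq_bigr => m _; rewrite mxE. Qed.

Lemma measurable_inv_oneDsqr : measurable_fun [set: R] (fun x : R => (oneDsqr x)^-1).
Proof. by apply: continuous_measurable_fun => x; exact: continuous_oneDsqrV. Qed.

Lemma measurable_weight_rv d :
  measurable_fun [set: d.-tuple (measurableTypeR R)] (fun t => weight (rv t)).
Proof.
under eq_fun do rewrite weight_rvE.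
apply: measurable_prod => m _.
apply: (measurableT_comp measurable_inv_oneDsqr).
exact: measurable_tnth.
Qed.

Lemma integral_inv_oneDsqr_lty :
  (\int[@lebesgue_measure R]_x ((oneDsqr x)^-1)%:E < +oo)%E.
Proof.
rewrite ge0_symfun_integralT.
- by rewrite -set_itvcy integral0y_oneDsqr -EFinM ltry.
- by move=> x; rewrite invr_ge0 (le_trans ler01).
- by move=> x; exact: continuous_oneDsqrV.
- by move=> x; rewrite /= /oneDsqr sqrrN.
Qed.

(** Induction on d by Tonelli: each new coordinate multiplies the integral by that of 1 / (1 + x^2)
    over the line. *)
Lemma integral_weight_lty d :
  (\int[lebesgue_Rd R d]_t (weight (rv t))%:E < +oo)%E.
Proof.
elim: d => [|d IH].
  rewrite (eq_integral (cst 1%E)); last first.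
    by move=> t _; rewrite weight_rvE big_ord0.
  by rewrite integral_cst//= diracE mul1e ltry.
rewrite /lebesgue_Rd -/(lebesgue_Rd R d) ge0_integral_pushforward//.
- have [m' mE] := sigma_finite_measure_pack (@lebesgue_Rd_sigma_finite R d).
  rewrite mE preimage_setT fubini_tonelli1.
  + rewrite (eq_integral (fun t => (weight (rv t))%:E *
        \int[@lebesgue_measure R]_x ((oneDsqr x)^-1)%:E)%E).
      rewrite ge0_integralZr//.
      + rewrite -mE; apply: lte_mul_pinfty.
        * by apply: integral_ge0 => t _; rewrite lee_fin weight_ge0.
        * rewrite ge0_fin_numE//; apply: integral_ge0 => t _.
          by rewrite lee_fin weight_ge0.
        * exact: integral_inv_oneDsqr_lty.
      + by apply/measurable_EFinP; exact: measurable_weight_rv.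
      + by move=> t _; rewrite lee_fin weight_ge0.
      + by apply: integral_ge0 => t _; rewrite lee_fin invr_ge0 (le_trans ler01).
    move=> t _; rewrite /fubini_F -ge0_integralZl//.
    + by apply: eq_integral => x _ /=; rewrite !weight_rvE big_ord_recl mulrC EFinM;
        congr (_ * _)%E; congr EFin; apply: eq_bigr => m _; rewrite tnthS.
    + by apply/measurable_EFinP; exact: measurable_inv_oneDsqr.
    + by rewrite lee_fin weight_ge0.
  + apply/measurable_EFinP.
    exact: (measurableT_comp (@measurable_weight_rv d.+1) (@measurable_tcons R d)).
  + by move=> t; rewrite lee_fin weight_ge0.
- exact: measurable_tcons.
- by apply/measurable_EFinP; exact: measurable_weight_rv.
- by move=> t _; rewrite lee_fin weight_ge0.
Qed.

Lemma integrable_weight_rv d :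
  (lebesgue_Rd R d).-integrable setT (fun t => (weight (rv t))%:E).
Proof.
apply/integrableP; split.
  by apply/measurable_EFinP; exact: measurable_weight_rv.
rewrite (eq_integral (fun t => (weight (rv t))%:E)); first exact: integral_weight_lty.
by move=> t _; rewrite gee0_abs// lee_fin weight_ge0.
Qed.

End weight_integrable.

(** * Wavelet coefficients of a constant series *)

Section Rintegral_lemmas.
Context dT (T : measurableType dT) (R : realType).
Variable mu : {measure set T -> \bar R}.

Lemma integrable_sumr (I : Type) (s : seq I) (f : I -> T -> R) :
  (forall i, mu.-integrable setT (EFin \o f i)) ->
  mu.-integrable setT (EFin \o (fun t => \sum_(i <- s) f i t)).
Proof.
move=> fi; have -> : EFin \o (fun t => \sum_(j <- s) f j t) =
    (fun t => \sum_(j <- s) (EFin \o f j) t)%E.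
  by apply/funext => t /=; rewrite sumEFin.
by apply: integrable_sum => // j _; exact: fi.
Qed.

Lemma integrable_Zl (r : R) (f : T -> R) : mu.-integrable setT (EFin \o f) ->
  mu.-integrable setT (EFin \o (fun t => r * f t)).
Proof.
by move=> /(integrableZl measurableT r); apply: eq_integrable.
Qed.

Lemma Rintegral_sum (I : Type) (s : seq I) (f : I -> T -> R) :
  (forall i, mu.-integrable setT (EFin \o f i)) ->
  \int[mu]_t (\sum_(i <- s) f i t) = \sum_(i <- s) \int[mu]_t f i t.
Proof.
move=> fi; elim: s => [|i s IH].
  by under eq_Rintegral do rewrite big_nil; rewrite big_nil /Rintegral integral0.
under eq_Rintegral do rewrite big_cons.
rewrite big_cons RintegralD ?IH//; exact: integrable_sumr.
Qed.

Lemma dominated_Rintegral (f_ : (T -> R)^nat) (f g : T -> R) :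
  (forall n, measurable_fun setT (f_ n)) ->
  (forall x, f_ n x @[n --> \oo] --> f x) ->
  mu.-integrable setT (EFin \o g) ->
  (forall n x, `|f_ n x| <= g x) ->
  mu.-integrable setT (EFin \o f) /\
  \int[mu]_x f_ n x @[n --> \oo] --> \int[mu]_x f x.
Proof.
move=> mf cf ig fg.
have mfE n : measurable_fun setT (EFin \o f_ n) by exact/measurable_EFinP.
have cfE x : setT x -> (EFin \o f_ n) x @[n --> \oo] --> (EFin \o f) x.
  by move=> _; apply: cvg_EFin (cf x); near=> n.
have mfl : measurable_fun setT (EFin \o f) by exact: emeasurable_fun_cvg mfE cfE.
have [||fint _ +] := dominated_convergence measurableT mfE mfl _ ig.
- by apply: aeW => x; exact: cfE.
- by apply: aeW => x n _; rewrite lee_fin.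
move=> h; split => //; apply: fine_cvg; move: h.
by rewrite /Rintegral fineK//; exact: integrable_fin_num.
Unshelve. all: by end_near. Qed.

End Rintegral_lemmas.

Section mother_functions.
Context {R : realType} {d : nat}.
Variables (phi : 'rV[R]_d -> R) (Psi : 'I_((2 ^ d).-1) -> 'rV[R]_d -> R).
Hypothesis hPsi : orthonormal_basis_L2 (basis_fun phi Psi).
Variable D : R.
Hypothesis PsiD : forall i, decay_bound D (Psi i).
Local Notation mu := (lebesgue_Rd R d).

Definition dilate (j : nat) (i : 'I_((2 ^ d).-1)) (k : 'rV[int]_d) (x : 'rV[R]_d) : R :=
  Psi i (2 ^+ j *: x - intv k).

(* The L^2 normalization of the wavelets of scale j. *)
Local Notation norm_const j := (2 `^ (d%:R * j%:R / 2) : R).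

Let norm_const_gt0 j : 0 < norm_const j. Proof. exact: powR_gt0. Qed.

Lemma measurable_dilate j i k : measurable_fun setT (dilate j i k \o @rv R d).
Proof.
have [/(_ (inr (j, i, k)))/sub_Lfun_mfun + _ _] := hPsi.
rewrite inE /= => mb.
have -> : dilate j i k \o @rv R d = (fun t => (norm_const j)^-1 *
    (basis_fun phi Psi (inr (j, i, k)) \o @rv R d) t).
  by apply/funext => t; rewrite /= mulKf// gt_eqF.
exact: measurable_funM.
Qed.

Lemma integrable_dilate_mul j i k j' i' k' : mu.-integrable setT
  (EFin \o (fun t => dilate j i k (rv t) * dilate j' i' k' (rv t))).
Proof.
have [hL _ _] := hPsi.
have := Lfun2_mul_Lfun1 (hL (inr (j, i, k))) (hL (inr (j', i', k'))).
move=> /Lfun1_integrable /(integrableZl measurableT (norm_const j * norm_const j')^-1).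
apply: eq_integrable => // t _; rewrite /= -EFinM; congr EFin.
by rewrite -!/(dilate _ _ _ _); field; rewrite !gt_eqF.
Qed.

Lemma Rintegral_dilate_mul j i k j' i' k' :
  \int[mu]_t (dilate j i k (rv t) * dilate j' i' k' (rv t)) =
  ((j, i, k) == (j', i', k'))%:R / norm_const j ^+ 2.
Proof.
have [_ hO _] := hPsi.
have := hO (inr (j, i, k)) (inr (j', i', k')).
rewrite (_ : (inr _ == inr _) = ((j, i, k) == (j', i', k')))// => h.
under eq_Rintegral => t _.
  rewrite (_ : _ * _ = (norm_const j * norm_const j')^-1 *
    (basis_fun phi Psi (inr (j, i, k)) (rv t) *
     basis_fun phi Psi (inr (j', i', k')) (rv t))); last first.
    by rewrite /= -!/(dilate _ _ _ _); field; rewrite !gt_eqF.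
  over.
rewrite RintegralZl//; last first.
  by apply/Lfun1_integrable; apply: Lfun2_mul_Lfun1; case: hPsi => + _ _; exact.
rewrite h mulrC; case: eqP => [[-> _ _]|]; first by rewrite expr2.
by rewrite !mul0r.
Qed.

(** With p = 2^j >= 1, u = x_m and v = k_m, u^2 <= (p u)^2 <= 2 (p u - v)^2 + 2 v^2. Thus wavelets
    of every scale and position are dominated by multiples of one integrable function. *)
Lemma weight_dilate_le (j : nat) (k : 'rV[int]_d) (x : 'rV[R]_d) :
  weight (2 ^+ j *: x - intv k) <=
  (\prod_m (2 * (1 + (k 0 m)%:~R ^+ 2))) * weight x.
Proof.
rewrite -big_split /=; apply: ler_prod => m _; rewrite !mxE.
have e0 (u : R) : 0 < 1 + u ^+ 2 by rewrite ltr_pwDl// sqr_ge0.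
rewrite invr_ge0 ltW//= ler_pdivlMr// mulrC ler_pdivrMr//.
have : 1 <= (2 ^+ j : R) by rewrite exprn_ege1// ler1n.
move: (2 ^+ j : R) (x 0 m) ((k 0 m)%:~R : R) => p u v p1.
have h1 := sqr_ge0 (p * u - v - v).
have h2 := sqr_ge0 (p * u - v).
have h3 := sqr_ge0 v.
have h4 : u ^+ 2 <= (p * u) ^+ 2.
  by rewrite exprMn ler_peMl ?sqr_ge0// exprn_ege1.
have h5 : 0 <= (p * u - v) ^+ 2 * v ^+ 2 by rewrite mulr_ge0.
set s := p * u - v in h1 h2 h5 *.
have e : p * u = s + v by rewrite /s subrK.
by rewrite e in h4; nra.
Qed.

Lemma dilate_le_weight j i k : exists2 M, 0 <= M & forall x : 'rV[R]_d,
  `|dilate j i k x| <= M * weight x.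
Proof.
have [D0 h _] := PsiD i.
exists (D * \prod_m (2 * (1 + (k 0 m)%:~R ^+ 2))).
  rewrite mulr_ge0// prodr_ge0// => m _.
  by rewrite mulr_ge0// addr_ge0// sqr_ge0.
move=> x; apply: (le_trans (h _)); rewrite -mulrA ler_wpM2l//.
exact: weight_dilate_le.
Qed.

Lemma integrable_scaled_weight (M : R) :
  mu.-integrable setT (EFin \o (fun t => M * weight (rv t))).
Proof.
have := integrableZl measurableT M (@integrable_weight_rv R d).
by apply: eq_integrable => // t _; rewrite /= EFinM.
Qed.

Lemma integrable_dilate j i k : mu.-integrable setT (EFin \o (dilate j i k \o @rv R d)).
Proof.
have [M M0 h] := dilate_le_weight j i k.
apply: le_integrable (integrable_scaled_weight M) => //.
  by apply/measurable_EFinP; exact: measurable_dilate.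
by move=> t _ /=; rewrite lee_fin [leRHS]ger0_norm// mulr_ge0// weight_ge0.
Qed.

End mother_functions.

Section wavelet_coefficients.
Context {R : realType} {d : nat}.
Variables (phi : 'rV[R]_d -> R) (Psi : 'I_((2 ^ d).-1) -> 'rV[R]_d -> R).
Hypothesis hPsi : orthonormal_basis_L2 (basis_fun phi Psi).
Variable D : R.
Hypothesis PsiD : forall i, decay_bound D (Psi i).
Local Notation mu := (lebesgue_Rd R d).
Local Notation norm_const j := (2 `^ (d%:R * j%:R / 2) : R).

(** The term l = 0 of the sum defining [periodized Psi v]. Integrating a periodic function against
    it over R^d plays the role of the scalar product with the periodized wavelet on the torus. *)
Definition dual_wavelet (v : torus_index d) : 'rV[R]_d -> R :=
  let: existT j (i, k) := v in dilate Psi j i (lattice_index k 0).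

Lemma Rintegral_dilate_dual j i (k : 'rV['I_(2 ^ j)]_d) l (v : torus_index d) :
  \int[mu]_t (dilate Psi j i (lattice_index k l) (rv t) * dual_wavelet v (rv t)) =
  ((existT _ j (i, k) == v) && (l == 0))%:R / norm_const j ^+ 2.
Proof.
case: v => j' [i' k']; rewrite (Rintegral_dilate_mul hPsi); congr (_%:R / _).
congr nat_of_bool; apply/eqP/andP => [[ej ei ek]|[/eqP e /eqP ->]].
  subst j' i'; have [-> ->] := lattice_index_inj ek.
  by rewrite !eqxx.
by have := congr1 (fun v : torus_index d => let: existT j (i, k) := v in
  (j, i, lattice_index k 0)) e.
Qed.

Lemma dual_wavelet_le (v : torus_index d) : exists2 M, 0 <= M &
  forall x, `|dual_wavelet v x| <= M * weight x.
Proof. by case: v => j [i k]; exact: (dilate_le_weight PsiD). Qed.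

Lemma integrable_dual_wavelet (v : torus_index d) :
  mu.-integrable setT (EFin \o (dual_wavelet v \o @rv R d)).
Proof. by case: v => j [i k]; exact: (integrable_dilate hPsi PsiD). Qed.

(** Dominated convergence in the truncation: truncated levels are bounded uniformly in n and the
    dual wavelet is integrable. Orthogonality keeps only the index v with l = 0. *)
Lemma Rintegral_level c j (v : torus_index d) :
  mu.-integrable setT (EFin \o (fun t => level Psi c j (rv t) * dual_wavelet v (rv t))) /\
  \int[mu]_t (level Psi c j (rv t) * dual_wavelet v (rv t)) =
  (if tag v == j then c v else 0) / norm_const j ^+ 2.
Proof.
(* A level has finitely many coefficients, and only the finiteness of A matters here. *)
pose A := \sum_(ik : 'I_((2 ^ d).-1) * 'rV['I_(2 ^ j)]_d) `|c (existT _ j ik)|.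
have cA ik : `|c (existT _ j ik)| <= A.
  by rewrite /A (bigD1 ik)//= lerDl sumr_ge0.
have [M M0 hM] := dual_wavelet_le v.
pose f_ n (t : d.-tuple (measurableTypeR R)) :=
  (\sum_(ik : 'I_((2 ^ d).-1) * 'rV['I_(2 ^ j)]_d)
     c (existT _ j ik) * truncated_periodized Psi n (existT _ j ik) (rv t)) *
  dual_wavelet v (rv t).
have f_E n t : f_ n t = \sum_(ik : 'I_((2 ^ d).-1) * 'rV['I_(2 ^ j)]_d)
    c (existT _ j ik) * \sum_(l <- enum_upto 'rV[int]_d n)
      (dilate Psi j ik.1 (lattice_index ik.2 l) (rv t) * dual_wavelet v (rv t)).
  rewrite /f_ mulr_suml; apply: eq_bigr => -[i k] _ /=.
  by rewrite -mulrA mulr_suml.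
have int1 ik l : mu.-integrable setT (EFin \o (fun t =>
    dilate Psi j ik.1 (@lattice_index d j ik.2 l) (rv t) * dual_wavelet v (rv t))).
  by case: v {f_ f_E hM} => j' [i' k']; exact: (integrable_dilate_mul hPsi).
have int2 n ik : mu.-integrable setT (EFin \o (fun t =>
    \sum_(l <- enum_upto 'rV[int]_d n)
      (dilate Psi j ik.1 (@lattice_index d j ik.2 l) (rv t) * dual_wavelet v (rv t)))).
  by apply: integrable_sumr => l; exact: int1.
have int3 n : mu.-integrable setT (EFin \o f_ n).
  rewrite (_ : f_ n = fun t => \sum_(ik : 'I_((2 ^ d).-1) * 'rV['I_(2 ^ j)]_d)
    c (existT _ j ik) * \sum_(l <- enum_upto 'rV[int]_d n)
      (dilate Psi j ik.1 (lattice_index ik.2 l) (rv t) * dual_wavelet v (rv t))).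
    by apply: integrable_sumr => ik; apply: integrable_Zl; exact: int2.
  by apply/funext => t; exact: f_E.
have [int_l lim1] : mu.-integrable setT (EFin \o (fun t =>
      level Psi c j (rv t) * dual_wavelet v (rv t))) /\
    \int[mu]_t f_ n t @[n --> \oo] -->
    \int[mu]_t (level Psi c j (rv t) * dual_wavelet v (rv t)).
  apply: (@dominated_Rintegral _ _ _ _ _ _
    (fun t => A * @level_const R d D * M * weight (rv t))).
  - by move=> n; apply/measurable_EFinP; exact: measurable_int (int3 n).
  - move=> t; apply: cvgMr_tmp; exact: truncated_level_cvg.
  - exact: integrable_scaled_weight.
  - move=> n t; rewrite normrM -mulrA; apply: ler_pM => //.
    exact: truncated_level_le.
split => //; apply: (cvg_unique _ lim1) => //.
have {int2 int1} fint n : \int[mu]_t f_ n t =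
    \sum_(ik : 'I_((2 ^ d).-1) * 'rV['I_(2 ^ j)]_d) c (existT _ j ik) *
      \sum_(l <- enum_upto 'rV[int]_d n)
        (((existT _ j ik == v) && (l == 0))%:R / norm_const j ^+ 2).
  under eq_Rintegral do rewrite f_E.
  rewrite Rintegral_sum; last by move=> ik; apply: integrable_Zl; exact: int2.
  apply: eq_bigr => ik _; rewrite RintegralZl//; congr (_ * _).
  rewrite Rintegral_sum//; apply: eq_bigr => l _.
  by rewrite Rintegral_dilate_dual -surjective_pairing.
(* The integrals are constant in n once the truncation contains l = 0. *)
apply: cvg_near_cst; exists (pickle (0 : 'rV[int]_d)).+1 => // n /= n0.
rewrite fint.
transitivity (\sum_(ik : 'I_((2 ^ d).-1) * 'rV['I_(2 ^ j)]_d)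
    c (existT _ j ik) * ((existT _ j ik == v)%:R / norm_const j ^+ 2)).
  apply: eq_bigr => ik _; congr (_ * _).
  rewrite (bigD1_seq 0) ?enum_upto_uniq ?mem_enum_upto//= eqxx andbT.
  rewrite big1 ?addr0// => l /negbTE ->; rewrite andbF mul0r//.
case: v {f_ f_E int3 int_l lim1 fint hM} => j' ik' /=; case: eqP => [jj|jj].
  subst j'; rewrite (bigD1 ik')//= eqxx mul1r big1 ?addr0// => ik ne.
  rewrite (_ : _ == _ = false) ?mul0r ?mulr0//.
  by apply/negbTE; apply: contra ne => /eqP e; apply/eqP; exact: eq_from_Tagged e.
rewrite big1 ?mul0r// => ik _; rewrite (_ : _ == _ = false) ?mul0r ?mulr0//.
by apply/negbTE/eqP => e; apply: jj; have := congr1 (@projT1 _ _) e.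
Qed.

End wavelet_coefficients.

Section constant_series.
Context {R : realType} {d : nat}.
Variables (phi : 'rV[R]_d -> R) (Psi : 'I_((2 ^ d).-1) -> 'rV[R]_d -> R) (D : R).
Hypothesis d_gt0 : (0 < d)%N.
Hypothesis hPsi : orthonormal_basis_L2 (basis_fun phi Psi).
Hypothesis PsiD : forall i, decay_bound D (Psi i).
Variables (alpha p A : R) (c : torus_index d -> R).
Hypotheses (alpha_gt0 : 0 < alpha) (alpha_lt1 : alpha < 1) (p_ge0 : 0 <= p).
Hypothesis A_ge0 : 0 <= A.
Hypothesis cA : forall u,
  `|c u| <= A * (2 `^ (- (alpha * (tag u)%:R)) * (tag u).+1%:R `^ p).
Local Notation mu := (lebesgue_Rd R d).
Local Notation norm_const j := (2 `^ (d%:R * j%:R / 2) : R).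

(** Dominated convergence over scales: the partial sums are bounded uniformly in n and x, so their
    products with the dual wavelet stay below a multiple of [weight]. Only the scale of v
    contributes; the squared constant compensates for the missing L^2 normalization. *)
Lemma constant_series_coef (kappa : R) :
  (forall x, wavelet_series Psi c x = kappa) -> forall v : torus_index d,
  c v = kappa * (norm_const (tag v) ^+ 2 * \int[mu]_t dual_wavelet Psi v (rv t)).
Proof.
move=> Xk v; have [M M0 hM] := dual_wavelet_le PsiD v.
have r1 : 2 `^ (- alpha) < 1 :> R by exact: pow2_lt1.
have [B B0 HB] := sum_geometric_powR_bounded (powR_gt0 (- alpha) (ltr0Sn R 1)) r1 p_ge0.
have D0 : 0 <= D.
  by case: (PsiD (Ordinal (wavelet_types_gt0 d_gt0))).
have K0 : 0 <= A * @level_const R d D by rewrite !mulr_ge0.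
pose f_ n (t : d.-tuple (measurableTypeR R)) :=
  wavelet_partial_sums Psi c (rv t) n * dual_wavelet Psi v (rv t).
have int1 j : mu.-integrable setT (EFin \o (fun t =>
    level Psi c j (rv t) * dual_wavelet Psi v (rv t))).
  by have [] := Rintegral_level hPsi PsiD c j v.
have f_E n t : f_ n t =
    \sum_(0 <= j < n) level Psi c j (rv t) * dual_wavelet Psi v (rv t).
  by rewrite /f_ /wavelet_partial_sums /series /= mulr_suml.
have [_ lim1] : mu.-integrable setT (EFin \o (fun t =>
      kappa * dual_wavelet Psi v (rv t))) /\
    \int[mu]_t f_ n t @[n --> \oo] -->
    \int[mu]_t (kappa * dual_wavelet Psi v (rv t)).
  apply: (@dominated_Rintegral _ _ _ _ _ _
    (fun t => A * @level_const R d D * B * M * weight (rv t))).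
  - move=> n; apply/measurable_EFinP.
    rewrite (_ : f_ n = (fun t =>
        \sum_(0 <= j < n) level Psi c j (rv t) * dual_wavelet Psi v (rv t))).
      by apply: measurable_int (integrable_sumr _ _); exact: int1.
    by apply/funext => t; exact: f_E.
  - move=> t; apply: cvgMr_tmp; rewrite -(Xk (rv t)) /wavelet_series.
    exact: (wavelet_partial_sums_cvg d_gt0 PsiD alpha_gt0 p_ge0 A_ge0 cA).
  - exact: integrable_scaled_weight.
  - move=> n t; rewrite normrM -mulrA; apply: ler_pM => //.
    apply: le_trans (ler_wpM2l K0 (HB n)); rewrite mulr_sumr.
    exact: (partial_sums_le PsiD cA).
rewrite RintegralZl// in lim1; last exact: (integrable_dual_wavelet hPsi PsiD).
have n2 : norm_const (tag v) ^+ 2 != 0 by rewrite gt_eqF// exprn_gt0// powR_gt0.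
have h : c v / norm_const (tag v) ^+ 2 = kappa * \int[mu]_t dual_wavelet Psi v (rv t).
  apply/esym; apply: (cvg_unique _ lim1) => //.
  apply: cvg_near_cst; exists (tag v).+1 => // n /= vn.
  under eq_Rintegral do rewrite f_E.
  rewrite Rintegral_sum; last exact: int1.
  rewrite (bigD1_seq (tag v)) ?iota_uniq ?mem_index_iota//=.
  rewrite (Rintegral_level hPsi PsiD _ _ _).2 eqxx.
  rewrite big1 ?addr0// => j jv.
  by rewrite (Rintegral_level hPsi PsiD _ _ _).2 eq_sym (negbTE jv) mul0r.
by rewrite mulrCA -h mulrC divfK.
Qed.

End constant_series.

(** * Random coefficients *)

Section almost_surely.
Context {dO : measure_display} {Omega : measurableType dO} {R : realType}.
Variable P : probability Omega R.

(** The properties below quantify over real constants and are not known to be measurable, so their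
    exceptional sets are covered by measurable events. The intersection of covers of probability at
    most 1/(n + 1) is null. *)
Lemma ae_of_small (Q : Omega -> Prop) :
  (forall eps : R, 0 < eps -> exists B, [/\ measurable B, (P B <= eps%:E)%E &
     forall w, ~ Q w -> B w]) ->
  {ae P, forall w, Q w}.
Proof.
move=> small.
have /choice[B hB] n : exists B, [/\ measurable B, (P B <= (n.+1%:R^-1)%:E)%E &
     forall w, ~ Q w -> B w] by apply: small; rewrite invr_gt0.
exists (\bigcap_n B n); split.
- by apply: bigcapT_measurable => n; have [] := hB n.
- apply/eqP; rewrite eq_le measure_ge0 andbT; apply/lee_addgt0Pr => e e0.
  rewrite add0e; pose n := Num.truncn e^-1.
  have [mB PB _] := hB n.
  apply: (@le_trans _ _ (P (B n))).
    apply: le_measure; rewrite ?inE//.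
      by apply: bigcapT_measurable => m; have [] := hB m.
    by move=> w; exact.
  apply: (le_trans PB); rewrite lee_fin -[leRHS]invrK lef_pV2 ?posrE ?invr_gt0//.
  by apply/ltW; exact: truncnS_gt.
- by move=> w nQ n _; have [_ _] := hB n; exact.
Qed.

End almost_surely.

Section iid.
Context {dO : measure_display} {Omega : measurableType dO} {R : realType} {d : nat}.
Variable P : probability Omega R.
Variable chi : torus_index d -> {RV P >-> R}.
Variable law : probability (measurableTypeR R) R.
Hypothesis hchi : iid_with_law chi law.

Definition norm_ge (x : R) : set R := [set y | x <= `|y|].

Lemma measurable_norm_ge x : measurable (norm_ge x : set (measurableTypeR R)).
Proof.
rewrite (_ : norm_ge x = ~` `](- x), x[%classic).
  by apply: measurableC; exact: measurable_itv.
apply/seteqP; split => y /=; rewrite in_itv /= -ltr_norml.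
  by move=> xy; rewrite ltNge xy.
by move=> /negP; rewrite -leNgt.
Qed.

Lemma measurable_chi u x : measurable (chi u @^-1` norm_ge x).
Proof.
rewrite -[X in measurable X]setTI; apply: measurable_funPT => //.
exact: measurable_norm_ge.
Qed.

Lemma prob_norm_ge u x : P (chi u @^-1` norm_ge x) = law (norm_ge x).
Proof. by have [_ h] := hchi; apply: h; exact: measurable_norm_ge. Qed.

Lemma prob_forall (s : seq (torus_index d)) (S : set R) :
  measurable (S : set (measurableTypeR R)) -> uniq s ->
  P (\bigcap_(u in [set` s]) (chi u @^-1` S)) = (fine (law S) ^+ size s)%:E.
Proof.
move=> mS us; have [h1 h2] := hchi.
rewrite (h1 s (fun=> S))//.
transitivity (\prod_(u <- s) (fine (law S))%:E)%E.
  apply: eq_bigr => u _; rewrite fineK//.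
    exact: h2.
  exact: fin_num_measure.
by rewrite prodEFin big_const_seq count_predT iter_mulr_1.
Qed.

Lemma measurable_forall (s : seq (torus_index d)) (S : set R) :
  measurable (S : set (measurableTypeR R)) ->
  measurable (\bigcap_(u in [set` s]) (chi u @^-1` S)).
Proof.
move=> mS; apply: fin_bigcap_measurable => [|u _]; first exact: finite_seq.
by rewrite -[X in measurable X]setTI; apply: measurable_funPT.
Qed.

Lemma expr_small (q eps : R) : 0 <= q -> q < 1 -> 0 < eps ->
  exists N : nat, forall n, (N <= n)%N -> q ^+ n <= eps.
Proof.
move=> q0 q1 e0; have : `|q| < 1 by rewrite ger0_norm.
move=> /cvg_expr/cvgrPdist_le/(_ _ e0)[N _ HN]; exists N => n Nn.
by have := HN n Nn; rewrite sub0r normrN ger0_norm// exprn_ge0.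
Qed.

(* Sort 2N indices by increasing |nu|. If chi is proportional to nu then |chi|
   increases along the sorted list, so either its first half stays below the
   level x or its second half stays above it. *)
Lemma not_proportional_ae (x : R) (nu : torus_index d -> R) :
  (0 < (2 ^ d).-1)%N ->
  (0 < law (norm_ge x))%E -> (law (norm_ge x) < 1)%E ->
  {ae P, forall w, ~ exists kappa, forall u, chi u w = kappa * nu u}.
Proof.
move=> I0 l0 l1; pose q := fine (law (norm_ge x)).
have lq : law (norm_ge x) = q%:E.
  by rewrite /q fineK// fin_num_measure//; exact: measurable_norm_ge.
have q0 : 0 < q by rewrite -lte_fin -lq.
have q1 : q < 1 by rewrite -lte_fin -lq.
have lqC : fine (law (~` norm_ge x)) = 1 - q.
  by rewrite probability_setC ?lq//; exact: measurable_norm_ge.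
apply: ae_of_small => eps e0.
have e2 : 0 < eps / 2 by rewrite divr_gt0.
have [N1 HN1] := expr_small (ltW q0) q1 e2.
have [N2 HN2] : exists N : nat, forall n, (N <= n)%N -> (1 - q) ^+ n <= eps / 2.
  by apply: expr_small => //; lra.
pose N := maxn N1 N2.
have p2 n : (0 < 2 ^ n)%N by rewrite expn_gt0.
(* One index per scale supplies as many distinct indices, hence independent variables, as
   required. *)
pose u (n : nat) : torus_index d := existT _ n
  (Ordinal I0, \row_m Ordinal (p2 n)).
have u_inj : injective u by move=> n m /(congr1 (@projT1 _ _)).
pose r : rel nat := fun a b => `|nu (u a)| <= `|nu (u b)|.
pose s := sort r (iota 0 (N + N)).
have ss : size s = (N + N)%N by rewrite size_sort size_iota.
have us : uniq s by rewrite sort_uniq iota_uniq.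
have r_tr : transitive r by move=> a b c'; exact: le_trans.
have r_tot : total r by move=> a b; exact: le_total.
have := sort_sorted r_tot (iota 0 (N + N)).
rewrite -/s (sorted_pairwise r_tr) -(cat_take_drop N s) pairwise_cat.
move=> /andP[/allrelP rr _].
pose s1 := map u (take N s); pose s2 := map u (drop N s).
have us1 : uniq s1 by rewrite map_inj_uniq// take_uniq.
have us2 : uniq s2 by rewrite map_inj_uniq// drop_uniq.
have z1 : size s1 = N by rewrite size_map size_take_min ss; apply/minn_idPl/leq_addr.
have z2 : size s2 = N by rewrite size_map size_drop ss addnK.
pose E1 := \bigcap_(v in [set` s1]) (chi v @^-1` (~` norm_ge x)).
pose E2 := \bigcap_(v in [set` s2]) (chi v @^-1` norm_ge x).
have mS := measurable_norm_ge x.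
have mE1 : measurable E1 by apply: measurable_forall; exact: measurableC.
have mE2 : measurable E2 by exact: measurable_forall.
exists (E1 `|` E2); split; first exact: measurableU.
  apply: (le_trans (measureU2 _ mE1 mE2)).
  have PE1 := prob_forall (measurableC mS) us1.
  have PE2 := prob_forall mS us2.
  have -> : (P E1 + P E2 = ((1 - q) ^+ N + q ^+ N)%:E)%E.
    by rewrite [P E1]PE1 [P E2]PE2 z1 z2 lqC.
  rewrite lee_fin [eps]splitr; apply: lerD.
    by rewrite HN2// leq_maxr.
  by rewrite HN1// leq_maxl.
move=> w /contrapT[kappa hk].
have [h|/existsNP[v /not_implyP[vs hv]]] :=
  pselect (forall v, v \in s1 -> ~ norm_ge x (chi v w)).
  by left => v /= vs; exact: h.
right => v' /= /mapP[b bs ->]; move: vs hv => /mapP[a' as1 ->] /contrapT.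
rewrite /= /norm_ge /= => /le_trans; apply.
by rewrite !hk !normrM ler_wpM2l//; exact: rr.
Qed.

End iid.

Lemma exists_large_powR (R : realType) (x0 b gamma Z : R) :
  0 < b -> 0 < gamma -> 0 <= Z ->
  exists x, [/\ x0 < x, 0 < x & Z <= b * x `^ gamma].
Proof.
move=> b0 g0 Z0; pose x := Num.max (`|x0| + 1) ((Z / b) `^ gamma^-1).
have x_gt0 : 0 < x by rewrite lt_max ltr_wpDl.
exists x; split => //.
  rewrite lt_max; apply/orP; left; apply: (le_lt_trans (ler_norm _)).
  by rewrite ltrDl.
rewrite mulrC -ler_pdivrMr//.
have Zb : 0 <= Z / b by rewrite divr_ge0// ltW.
rewrite -[leLHS]powRr1// -(mulVf (lt0r_neq0 g0)) powRrM.
apply: ge0_ler_powR; rewrite ?nnegrE ?powR_ge0 ?(ltW x_gt0) ?(ltW g0)//.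
by rewrite le_max lexx orbT.
Qed.

Section growth.
Context {dO : measure_display} {Omega : measurableType dO} {R : realType} {d : nat}.
Variable P : probability Omega R.
Variable chi : torus_index d -> {RV P >-> R}.
Variable law : probability (measurableTypeR R) R.
Hypothesis hchi : iid_with_law chi law.

Lemma measure_big_setU_le (I : Type) (s : seq I) (F : I -> set Omega) :
  (forall i, measurable (F i)) ->
  (P (\big[setU/set0]_(i <- s) F i) <= \sum_(i <- s) P (F i))%E.
Proof.
move=> mF; elim: s => [|i s IH]; first by rewrite !big_nil measure0.
rewrite !big_cons; apply: le_trans (leeD (lexx _) IH).
by apply: measureU2 => //; exact: bigsetU_measurable.
Qed.

Lemma card_scale_le j :
  (#|{: 'I_((2 ^ d).-1) * 'rV['I_(2 ^ j)]_d}| <= (2 ^ d) ^ j.+1)%N.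
Proof.
rewrite card_prod card_mx !card_ord mul1n -expnM mulnC expnM expnSr.
rewrite -!expnM [(j * d)%N]mulnC.
by rewrite leq_mul2l leq_pred orbT.
Qed.

(** With threshold x (j + 1)^(1/gamma) at scale j, the tail is at most C e^(-b x^gamma (j + 1)),
    against at most 2^(d (j + 1)) indices. So scale j fails with probability at most C y^(j+1),
    where y = 2^d e^(-b x^gamma), and A = x works outside these failures. *)
Lemma growth_ae (C b gamma x0 : R) : 0 < C -> 0 < b -> 0 < gamma ->
  (forall x, x0 < x -> (law (norm_ge x) <= (C * expR (- b * x `^ gamma))%:E)%E) ->
  {ae P, forall w, exists2 A, 0 <= A &
    forall u, `|chi u w| <= A * (tag u).+1%:R `^ gamma^-1}.
Proof.
move=> C0 b0 g0 tail; apply: ae_of_small => eps e0.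
(* For y <= delta, the bound 1/2 makes the geometric sum of ratio y at most 2, and the other makes
   the total 2 C y at most eps. *)
pose delta := Num.min 2^-1 (eps / (2 * C)).
have delta0 : 0 < delta by rewrite lt_min invr_gt0 ltr0n divr_gt0 ?mulr_gt0.
(* Since e^u >= u, the choice Z <= b x^gamma forces y <= 2^d / Z = delta. *)
pose Z : R := (2 ^ d)%N%:R / delta.
have N0 : 0 < (2 ^ d)%N%:R :> R by rewrite ltr0n expn_gt0.
have Z0 : 0 < Z by rewrite divr_gt0.
have [x [x00 x_gt0 xZ]] := exists_large_powR x0 b0 g0 (ltW Z0).
pose y : R := (2 ^ d)%N%:R * expR (- b * x `^ gamma).
have y0 : 0 <= y by rewrite mulr_ge0// expR_ge0.
have yd : y <= delta.
  have -> : delta = (2 ^ d)%N%:R * Z^-1.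
    by rewrite /Z invfM invrK mulrA divff ?mul1r// gt_eqF.
  rewrite ler_wpM2l// mulNr expRN lef_pV2 ?posrE ?expR_gt0//.
  apply: (le_trans xZ); apply: le_trans (expR_ge1Dx _).
  by rewrite lerDr.
have y2 : y <= 2^-1 by apply: (le_trans yd); rewrite ge_min lexx.
have yC : C * y * 2 <= eps.
  have : y <= eps / (2 * C) by apply: (le_trans yd); rewrite ge_min lexx orbT.
  by rewrite ler_pdivlMr ?mulr_gt0//; lra.
pose lev j := x * j.+1%:R `^ gamma^-1.
have lev_x0 j : x0 < lev j.
  apply: (lt_le_trans x00); rewrite /lev ler_peMr ?(ltW x_gt0)//.
  have h1 : (1 : R) `^ gamma^-1 = 1 by rewrite powR1.
  rewrite -[leLHS]h1; apply: ge0_ler_powR;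
    rewrite ?nnegrE ?invr_ge0 ?(ltW g0)//.
  by rewrite ler1n.
have lev_g j : lev j `^ gamma = x `^ gamma * j.+1%:R.
  rewrite powRM ?powR_ge0 ?(ltW x_gt0)// -powRrM mulVf ?gt_eqF//.
  by rewrite powRr1.
pose F j := \big[setU/set0]_(ik : 'I_((2 ^ d).-1) * 'rV['I_(2 ^ j)]_d)
  (chi (existT _ j ik) @^-1` norm_ge (lev j)).
have mF j : measurable (F j).
  by apply: bigsetU_measurable => ik _; exact: measurable_chi.
have PF j : (P (F j) <= (C * y * y ^+ j)%:E)%E.
  apply: (le_trans (measure_big_setU_le _ _)).
    by move=> ik; exact: measurable_chi.
  apply: (@le_trans _ _ (\sum_(ik : 'I_((2 ^ d).-1) * 'rV['I_(2 ^ j)]_d)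
      (C * expR (- b * x `^ gamma) ^+ j.+1)%:E)%E).
    apply: lee_sum => ik _; rewrite (prob_norm_ge hchi).
    apply: (le_trans (tail _ (lev_x0 j))).
    rewrite lev_g (_ : - b * _ = j.+1%:R * (- b * x `^ gamma)); last by ring.
    by rewrite expRM_natl.
  rewrite sumEFin lee_fin sumr_const -mulr_natr.
  rewrite -[C * y * _]mulrA -exprS /y exprMn -mulrA ler_pM2l// mulrC.
  rewrite ler_wpM2r ?exprn_ge0 ?expR_ge0//.
  by rewrite -natrX ler_nat; exact: card_scale_le.
exists (\bigcup_j F j); split.
- exact: bigcup_measurable.
- have mU : measurable (\bigcup_j F j) by exact: bigcup_measurable.
  have PU : (P (\bigcup_j F j) <= \sum_(0 <= j <oo) P (F j))%E.
    exact: measure_sigma_subadditive.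
  apply: (le_trans PU).
  apply: (@le_trans _ _ (\sum_(0 <= j <oo) (C * y * y ^+ j)%:E)%E).
    exact: lee_nneseries.
  apply: lime_le.
    apply: is_cvg_nneseries => j _ _.
    by rewrite lee_fin !mulr_ge0 ?exprn_ge0// ltW.
  apply: nearW => n; rewrite sumEFin lee_fin -mulr_sumr.
  apply: le_trans yC; apply: ler_wpM2l; first by rewrite mulr_ge0// ltW.
  apply: le_trans (sum_geometric_le _ y0 _) _; first lra.
  rewrite -[leRHS]invrK lef_pV2 ?posrE; lra.
- move=> w nQ; apply: contrapT => nF; apply: nQ; exists x; first exact: ltW.
  move=> [j ik] /=; rewrite leNgt; apply/negP => h; apply: nF.
  exists j => //; rewrite /F -bigcup_seq; exists ik => /=.
    exact: mem_index_enum.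
  exact: ltW.
Qed.

End growth.

(** * The log-Hölder supremum and the conclusion *)

Lemma decay_bound_le (R : realType) (d : nat) (D D' : R) (g : 'rV[R]_d -> R) :
  D <= D' -> decay_bound D g -> decay_bound D' g.
Proof.
move=> DD [D0 h1 h2]; split.
- exact: le_trans DD.
- by move=> x; apply: (le_trans (h1 x)); rewrite ler_wpM2r// weight_ge0.
- move=> x y xy; apply: (le_trans (h2 x y xy)).
  by rewrite !ler_wpM2r// weight_ge0.
Qed.

Lemma wavelet_decay_bound (R : realType) (d : nat)
    (Psi : 'I_((2 ^ d).-1) -> 'rV[R]_d -> R) :
  (forall i, smooth_fast_decay 1 (Psi i)) ->
  exists D, forall i, decay_bound D (Psi i).
Proof.
move=> sPsi.
have /choice[D hD] i : exists D, decay_bound D (Psi i) by exact: smooth_fast_decay_bound.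
exists (\sum_i D i) => i; apply: decay_bound_le (hD i).
by rewrite (bigD1 i)//= lerDl sumr_ge0// => i' _; case: (hD i').
Qed.

Section log_holder.
Context {R : realType} {d : nat}.
Variables (alpha gamma : R) (X : 'rV[R]_d -> R).
Hypothesis Xper : forall x l, X (x + intv l) = X x.

(** The torus distance lies in (0, 1/2], so its logarithm does not vanish and the quotients are
    never divisions by zero. *)
Lemma log_holder_denom_gt0 (x y : 'rV[R]_d) : ~ same_point x y ->
  0 < torus_dist x y `^ alpha * `|ln (torus_dist x y)| `^ gamma^-1.
Proof.
move=> xy; have t0 := torus_dist_gt0 xy; have [l [_ t2]] := torus_dist_attained x y.
rewrite mulr_gt0// powR_gt0// normr_gt0 lt_eqF// ln_lt0// t0/=.
by apply: (le_lt_trans t2); rewrite invf_lt1// ltr1n.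
Qed.

(** By periodicity y can be replaced by its representative nearest to x, for which the norm of the
    difference is the torus distance. *)
Lemma log_holder_sup_lty (H : R) :
  (forall x y : 'rV[R]_d, 0 < `|x - y| -> `|x - y| <= 2^-1 ->
    `|X x - X y| <= H * (`|x - y| `^ alpha * `|ln `|x - y| | `^ gamma^-1)) ->
  (log_holder_sup alpha gamma X < +oo)%E.
Proof.
move=> XH; apply: (@le_lt_trans _ _ H%:E); last exact: ltry.
apply: ge_ereal_sup => _ [[x y] /= xy <-]; rewrite lee_fin.
rewrite ler_pdivrMr ?log_holder_denom_gt0//.
have t0 := torus_dist_gt0 xy; have [l [tE t2]] := torus_dist_attained x y.
rewrite -(Xper y l); have e : `|x - (y + intv l)| = torus_dist x y.
  by rewrite tE opprD addrA.
by have := XH x (y + intv l); rewrite e; apply.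
Qed.

Lemma log_holder_sup_le0_constant :
  (log_holder_sup alpha gamma X <= 0)%E -> forall x, X x = X 0.
Proof.
move=> sup0 x; have [[l xl]|xy] := pselect (same_point x 0).
  by rewrite -[x]subr0 xl -[intv l]add0r Xper.
have : ((`|X x - X 0| / (torus_dist x 0 `^ alpha *
    `|ln (torus_dist x 0)| `^ gamma^-1))%:E <= 0)%E.
  by apply: le_trans sup0; apply: ereal_sup_ubound; exists (x, 0).
rewrite lee_fin ler_pdivrMr ?log_holder_denom_gt0// mul0r normr_le0 subr_eq0.
by move/eqP.
Qed.

End log_holder.

(** [limn] takes a default value on divergent sequences, so the conclusion also asserts convergence
    at every point, which makes [wavelet_series] the actual sum. *)
Theorem proposition5p4 (R : realType) (d : nat) (d_gt0 : (0 < d)%N)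
    (phi : 'rV[R]_d -> R) (Psi : 'I_((2 ^ d).-1) -> 'rV[R]_d -> R)
    (hPsi : wavelet_basis 1 phi Psi)
    (dO : measure_display) (Omega : measurableType dO) (P : probability Omega R)
    (chi : torus_index d -> {RV P >-> R})
    (law : probability (measurableTypeR R) R)
    (hchi : iid_with_law chi law)
    (C C' a b gamma : R) (C_gt0 : 0 < C) (C'_gt0 : 0 < C')
    (a_gt0 : 0 < a) (b_gt0 : 0 < b) (gamma_gt0 : 0 < gamma) (gamma_le2 : gamma <= 2)
    (tail : \forall x \near +oo,
      ((C' * expR (- a * x `^ gamma))%:E <= law [set y : R | (x <= `|y|)%R])%E /\
      (law [set y : R | (x <= `|y|)%R] <= (C * expR (- b * x `^ gamma))%:E)%E)
    (alpha : R) (alpha_gt0 : 0 < alpha) (alpha_lt1 : alpha < 1) :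
  {ae P, forall w,
    let c := randomized_coef (f_coef alpha) chi w in
    (forall x : 'rV[R]_d, cvgn (wavelet_partial_sums Psi c x)) /\
    (0 < log_holder_sup alpha gamma (wavelet_series Psi c) < +oo)%E}.
Proof.
have [_ /wavelet_decay_bound[D PsiD] hL2] := hPsi.
have [x0 [_ htail]] := tail.
have growth := growth_ae hchi C_gt0 b_gt0 gamma_gt0 (fun x xx => (htail x xx).2).
(* At this x the lower tail bound gives positive mass to |y| >= x, and C <= b x^gamma < e^(b
   x^gamma) keeps that mass below 1: the law charges both sides of x. *)
have [x [x0x x_gt0 xC]] := exists_large_powR x0 b_gt0 gamma_gt0 (ltW C_gt0).
have [lo up] := htail x x0x.
have law_gt0 : (0 < law (norm_ge x))%E.
  by apply: lt_le_trans lo; rewrite lte_fin mulr_gt0// expR_gt0.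
have law_lt1 : (law (norm_ge x) < 1)%E.
  apply: (le_lt_trans up); rewrite lte_fin mulNr expRN ltr_pdivrMr ?expR_gt0// mul1r.
  apply: (le_lt_trans xC); apply: lt_le_trans (expR_ge1Dx _).
  by rewrite ltrDr.
pose scale (u : torus_index d) : R := 2 `^ (- (alpha * (tag u)%:R)).
have scale_gt0 u : 0 < scale u by exact: powR_gt0.
(* The coefficient that [constant_series_coef] gives for kappa = 1, divided by the deterministic
   factor 2^(-alpha j). *)
pose nu (v : torus_index d) : R := (scale v)^-1 *
  (2 `^ (d%:R * (tag v)%:R / 2) ^+ 2 *
   \int[lebesgue_Rd R d]_t dual_wavelet Psi v (rv t)).
have nonprop := not_proportional_ae hchi nu (wavelet_types_gt0 d_gt0) law_gt0 law_lt1.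
apply: filterS2 growth nonprop => w [A A0 hA] hw.
set c := randomized_coef _ _ _.
have g_ge0 : 0 <= gamma^-1 by rewrite invr_ge0 ltW.
have cA u : `|c u| <= A * (2 `^ (- (alpha * (tag u)%:R)) * (tag u).+1%:R `^ gamma^-1).
  rewrite /c /randomized_coef /f_coef normrM ger0_norm ?powR_ge0// mulrCA.
  by rewrite ler_wpM2l ?powR_ge0.
have per y l : wavelet_series Psi c (y + intv l) = wavelet_series Psi c y.
  exact: wavelet_series_shift.
split.
  by move=> y; exact: (wavelet_partial_sums_cvg d_gt0 PsiD alpha_gt0 g_ge0 A0 cA).
apply/andP; split; last first.
  have [H H0 XH] := wavelet_series_sub_le d_gt0 PsiD alpha_gt0 alpha_lt1 g_ge0 A0 cA.
  exact: log_holder_sup_lty per _ XH.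
rewrite ltNge; apply/negP => /(log_holder_sup_le0_constant per) Xconst.
apply: hw; exists (wavelet_series Psi c 0) => u.
have cu := constant_series_coef d_gt0 hL2 PsiD alpha_gt0 g_ge0 A0 cA Xconst u.
rewrite /nu mulrCA -cu /c /randomized_coef /f_coef -/(scale u).
by rewrite mulKf// gt_eqF.
Qed.
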